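(* Let $\sigma\ge2$, $\epsilon>0$, $L_c>0$, and consider a constant space mesh $\Delta x=2L_c/N$ (with $N\geq 1$ an integer and grid points $x_j=-L_c+j\,\Delta x$, $0\le j\le N$) and a constant time step $\Delta t>0$, with $t_m=m\,\Delta t$. Let $(u^m)_m$ be the solution of the mass-energy conservative (MEC) scheme with deterministic initial value $u^0$, $u^0_j=u_0(x_j)$ with $u_0\in H^1(\mathbb R)$, driven by the discretized spatially homogeneous multiplicative noise with renormalized covariance matrix $\tilde\Gamma$ (scheme, noise and $\tilde\Gamma$ as described in the context). Suppose that $\sup_{0\le k\le N}\tilde\Gamma(k,k)\le\delta^2$ for some constant $\delta>0$. Let $\tau^*$ denote the random existence time of this scheme. Then for every time $t_M$ of the time grid with $t_M<\tau^*$ almost surely, and for $\Delta x\in(0,1)$, $$\mathbb E\big(H_{\rm dis}[u^M]\big)\le H_{\rm dis}[u^0]+\frac{\epsilon\,M_{\rm dis}[u^0]}{\sqrt2\,(\Delta t)^{3/2}}\,\delta\,\sqrt{\ln(4L_c)+|\ln(\Delta x)|}\;t_M,$$ and $$\mathbb E\Big(\max_{0\le m\le M}H_{\rm dis}[u^m]\Big)\le H_{\rm dis}[u^0]+\frac{\sqrt2\,\epsilon\,M_{\rm dis}[u^0]}{(\Delta t)^{3/2}}\,\delta\,\sqrt{\ln(4L_c)+|\ln(\Delta x)|}\;t_M.$$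
   Context: All notation is for the constant space mesh $\Delta x$ and the constant time step $\Delta t$. **Underlying equation (motivation).** The scheme discretizes the 1D focusing stochastic NLS $iu_t+u_{xx}+|u|^{2\sigma}u=\epsilon\,u\circ dW$ (Stratonovich), $u(0)=u_0$. **Grid functions.** $u^m=(u^m_0,\dots,u^m_N)\in\mathbb C^{N+1}$ approximates $u(t_m,x_j)$. Neumann boundary conditions are imposed through pseudo-points: $u^m_{-1}=u^m_0$ and $u^m_{N+1}=u^m_N$. Set $u_j^{m+\frac12}=\frac12(u_j^m+u_j^{m+1})$ and $$\mathcal D_2 f_j=\frac{f_{j-1}-2f_j+f_{j+1}}{(\Delta x)^2},\qquad 0\le j\le N.$$ **Covariance matrix.** Let $\tilde\Phi$ be a function, defined almost everywhere, that is the density of a measure which is the Fourier transform of a tempered symmetric measure $\mu$ on $\mathbb R$ (the spectral measure). With $x_{j+\frac12}=\frac12(x_j+x_{j+1})$, let $$\tilde e_j=\frac1{\sqrt{\Delta x}}1_{[x_{j-\frac12},x_{j+\frac12}]}\ (1\le j\le N-1),\quad \tilde e_0=\frac{\sqrt2}{\sqrt{\Delta x}}1_{[x_0,x_{\frac12}]},\quad \tilde e_N=\frac{\sqrt2}{\sqrt{\Delta x}}1_{[x_{N-\frac12},x_N]},$$ and $$\Gamma(j,k)=\int_{\mathbb R}dx\int_{\mathbb R}\tilde e_j(x)\,\tilde\Phi(|x-y|)\,\tilde e_k(y)\,dy,\qquad \tilde\Gamma(j,k)=\frac1{\Delta x}\,\Gamma(j,k),\qquad 0\le j,k\le N.$$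 The symmetric matrix $\tilde\Gamma$ is positive definite. Let $A$ be the lower triangular matrix of its Cholesky decomposition $\tilde\Gamma=AA^*$ ($A^*$ is the transpose of $A$). **Discretized noise.** Let $\chi^{m+\frac12}=(\chi_0^{m+\frac12},\dots,\chi_N^{m+\frac12})$, $m\ge0$, be independent Gaussian vectors whose components are independent $\mathcal N(0,1)$ random variables. Set $$\tilde f^{\,m+\frac12}=\frac1{\sqrt{\Delta t}}\,A\,\chi^{m+\frac12},\qquad f_j^{m+\frac12}=\tfrac12\,(u_j^m+u_j^{m+1})\,\tilde f_j^{\,m+\frac12},\quad 0\le j\le N.$$ **MEC scheme.** For $m\ge0$ and $0\le j\le N$, $$i\,\frac{u_j^{m+1}-u_j^m}{\Delta t}+\mathcal D_2u_j^{m+\frac12}+\frac1{\sigma+1}\,\frac{|u_j^{m+1}|^{2(\sigma+1)}-|u_j^m|^{2(\sigma+1)}}{|u_j^{m+1}|^2-|u_j^m|^2}\,u_j^{m+\frac12}=\epsilon f_j^{m+\frac12}.$$ When $|u_j^{m+1}|=|u_j^m|$, the difference quotient is understood as its limit $(\sigma+1)|u_j^m|^{2\sigma}$. The scheme is solved step by step: $u^{m+1}$ is obtained as a (measurable) function of $u^m$ and of $\chi^{m+\frac12}$. The existence time $\tau^*$ is the (random) time up to which the scheme has a solution; $t_M<\tau^*$ means in particular that $u^0,\dots,u^M$ are defined. **Discrete mass and energy.** $$M_{\rm dis}[u^m]=\Delta x\sum_{j=0}^N|u_j^m|^2,\qquad H_{\rm dis}[u^m]=\frac12\sum_{j=0}^N\Big|\frac{u_{j+1}^m-u_j^m}{\Delta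 x}\Big|^2\Delta x-\frac1{2(\sigma+1)}\sum_{j=0}^N|u_j^m|^{2(\sigma+1)}\,\Delta x.$$ *)

(* Defs.v *)
From HB Require Import structures.
From mathcomp Require Import all_boot all_order all_algebra.
From mathcomp Require Import complex.
From mathcomp Require Import all_classical all_reals all_analysis.

Set Implicit Arguments.
Unset Strict Implicit.
Unset Printing Implicit Defensive.

Import Order.TTheory GRing.Theory Num.Theory.
Import numFieldNormedType.Exports.
Import ComplexField.Normc.

Local Open Scope classical_set_scope.
Local Open Scope complex_scope.
Local Open Scope ring_scope.

(* Borel sigma-algebra of C, through the identification of C with R * R.      *)
Definition complex_coords (R : realType) (z : R[i]) : R * R :=
  (complex.Re z, complex.Im z).

Definition complex_measurable (R : realType) : set (set R[i]) :=
  preimage_set_system setT (@complex_coords R) measurable.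

Lemma complex_measurable_sigma (R : realType) :
  sigma_algebra setT (@complex_measurable R).
Proof. exact: sigma_algebra_preimage (@sigma_algebra_measurable _ _). Qed.

Lemma complex_measurable0 (R : realType) : @complex_measurable R set0.
Proof. by case: (complex_measurable_sigma R). Qed.

Lemma complex_measurableC (R : realType) (A : set R[i]) :
  complex_measurable A -> complex_measurable (~` A).
Proof.
by case: (complex_measurable_sigma R) => _ + _ mA; rewrite -setTD; exact.
Qed.

Lemma complex_measurable_bigcup (R : realType) (F : (set R[i])^nat) :
  (forall n, complex_measurable (F n)) -> complex_measurable (\bigcup_n F n).
Proof. by case: (complex_measurable_sigma R) => _ _; exact. Qed.

Fact complex_display : measure_display. Proof. by []. Qed.

HB.instance Definition _ (R : realType) := isPointed.Build R[i] 0.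
HB.instance Definition _ (R : realType) := @isMeasurable.Build complex_display
  R[i] (@complex_measurable R) (@complex_measurable0 R)
  (@complex_measurableC R) (@complex_measurable_bigcup R).

Definition state (R : realType) (N : nat) := (N.+1).-tuple R[i].
Definition noise (R : realType) (N : nat) := (N.+1).-tuple R.

HB.instance Definition _ (R : realType) (N : nat) :=
  Measurable.on (state R N).
HB.instance Definition _ (R : realType) (N : nat) :=
  Measurable.on (noise R N).

Definition complex_Rintegral d (T : measurableType d) (R : realType)
    (mu : {measure set T -> \bar R}) (f : T -> R[i]) : R[i] :=
  (\int[mu]_x complex.Re (f x)) +i* (\int[mu]_x complex.Im (f x)).

Definition test_function (R : realType) (phi : R -> R) : Prop :=
  (forall n x, derivable (phi^`(n))%classic x 1) /\
  (exists a : R, forall x, a < `|x| -> phi x = 0).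

Definition weak_derivative (R : realType) (f g : R -> R) : Prop :=
  forall phi : R -> R, test_function phi ->
    \int[lebesgue_measure]_x (f x * (phi^`())%classic x) =
    - \int[lebesgue_measure]_x (g x * phi x).

Definition real_H1 (R : realType) (f : R -> R) : Prop :=
  f \in Lfun lebesgue_measure 2%:E /\
  (exists2 g : R -> R, g \in Lfun lebesgue_measure 2%:E & weak_derivative f g).

(* Elements of H^1(R) are evaluated at the grid points, hence the choice of   *)
(* the continuous representative.                                             *)
Definition H1 (R : realType) (f : R -> R[i]) : Prop :=
  [/\ real_H1 (@complex.Re R \o f), real_H1 (@complex.Im R \o f),
      continuous (@complex.Re R \o f : R -> R) &
      continuous (@complex.Im R \o f : R -> R)].

Definition tempered_measure (R : realType)
    (mu : {measure set (measurableTypeR R) -> \bar R}) : Prop :=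
  exists p : nat,
    (\int[mu]_x (((1 + x ^+ 2) ^- p : R)%:E) < +oo)%E.

Definition symmetric_measure (R : realType)
    (mu : {measure set (measurableTypeR R) -> \bar R}) : Prop :=
  forall B : set R, measurable B -> mu (-%R @^-1` B) = mu B.

Definition fourier (R : realType) (phi : R -> R) (xi : R) : R[i] :=
  complex_Rintegral lebesgue_measure
    (fun x : measurableTypeR R =>
       (phi x)%:C * (cos (x * xi) -i* sin (x * xi))).

(* The Fourier transform of the tempered measure mu, as a distribution, is    *)
(* the measure Phi(x) dx. The values of Phi on a null set are irrelevant, and *)
(* Phi is not required to be nonnegative.                                     *)
Definition fourier_density (R : realType)
    (mu : {measure set (measurableTypeR R) -> \bar R}) (Phi : R -> R) : Prop :=
  locally_integrable setT Phi /\
  (forall phi : R -> R, test_function phi ->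
    complex_Rintegral mu (fourier phi) =
    (\int[lebesgue_measure]_x (Phi x * phi x))%:C).

Definition mesh (R : realType) (Lc : R) (N : nat) : R := 2 * Lc / N%:R.

Definition gridpt (R : realType) (Lc : R) (N j : nat) : R :=
  - Lc + j%:R * mesh Lc N.

(* midpt Lc N j is x_{j+1/2}. *)
Definition midpt (R : realType) (Lc : R) (N j : nat) : R :=
  (gridpt Lc N j + gridpt Lc N j.+1) / 2.

Definition etilde (R : realType) (Lc : R) (N j : nat) (x : R) : R :=
  let s := Num.sqrt (mesh Lc N) in
  if j == 0%N then
    Num.sqrt 2 / s * \1_(`[gridpt Lc N 0, midpt Lc N 0]) x
  else if j == N then
    Num.sqrt 2 / s * \1_(`[midpt Lc N N.-1, gridpt Lc N N]) x
  else s^-1 * \1_(`[midpt Lc N j.-1, midpt Lc N j]) x.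

Definition Gamma_mx (R : realType) (Lc : R) (N : nat) (Phi : R -> R) :
    'M[R]_N.+1 :=
  \matrix_(j, k) \int[lebesgue_measure]_x \int[lebesgue_measure]_y
    (etilde Lc N j x * Phi `|x - y| * etilde Lc N k y).

Definition Gammatilde (R : realType) (Lc : R) (N : nat) (Phi : R -> R) :
    'M[R]_N.+1 :=
  (mesh Lc N)^-1 *: Gamma_mx Lc N Phi.

Definition symmetric_posdef (R : realType) (n : nat) (G : 'M[R]_n) : Prop :=
  G^T = G /\
  (forall v : 'cV[R]_n, v != 0 -> 0 < (v^T *m G *m v) ord0 ord0).

Definition cholesky (R : realType) (n : nat) (G A : 'M[R]_n) : Prop :=
  [/\ is_trig_mx A, forall i, 0 < A i i & G = A *m A^T].

Definition mutually_independent (R : realType) d (Omega : measurableType d)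
    (P : probability Omega R) (I : eqType) d' (S : measurableType d')
    (X : I -> Omega -> S) : Prop :=
  forall (J : seq I) (B : I -> set S), uniq J ->
    (forall i, measurable (B i)) ->
    fine (P [set w | forall i, i \in J -> B i (X i w)]) =
    \prod_(i <- J) fine (P (X i @^-1` B i)).

Definition gaussian_noise (R : realType) d (Omega : measurableType d)
    (P : probability Omega R) (N : nat)
    (chi : nat -> Omega -> noise R N) : Prop :=
  [/\ forall m, measurable_fun setT (chi m),
      mutually_independent P chi,
      forall m, mutually_independent P (fun j w => tnth (chi m w) j) &
      forall m j (B : set R), measurable B ->
        P [set w | B (tnth (chi m w) j)] = normal_prob 0 1 B].

(* Neumann pseudo-points: u_{-1} = u_0, as 0.-1 = 0, and u_{N+1} = u_N.       *)
Definition left_nb (N : nat) (j : 'I_N.+1) : 'I_N.+1 := inord j.-1.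
Definition right_nb (N : nat) (j : 'I_N.+1) : 'I_N.+1 := inord (minn j.+1 N).

Definition D2 (R : realType) (N : nat) (dx : R) (f : 'I_N.+1 -> R[i])
    (j : 'I_N.+1) : R[i] :=
  (f (left_nb j) - 2 * f j + f (right_nb j)) / (dx ^+ 2)%:C.

Definition midstate (R : realType) (N : nat) (v w : state R N)
    (j : 'I_N.+1) : R[i] :=
  (tnth v j + tnth w j) / 2.

(* a and b are |u_j^{m+1}| and |u_j^m|. *)
Definition nonlinearity (R : realType) (sigma a b : R) : R :=
  (sigma + 1)^-1 *
  (if a == b then (sigma + 1) * b `^ (2 * sigma)
   else (a `^ (2 * (sigma + 1)) - b `^ (2 * (sigma + 1))) /
        (a ^+ 2 - b ^+ 2)).

Definition ftilde (R : realType) (N : nat) (dt : R) (A : 'M[R]_N.+1)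
    (x : noise R N) (j : 'I_N.+1) : R :=
  (Num.sqrt dt)^-1 * \sum_k A j k * tnth x k.

Definition mec_step (R : realType) (N : nat) (sigma eps dx dt : R)
    (A : 'M[R]_N.+1) (v : state R N) (x : noise R N) (w : state R N) : Prop :=
  forall j : 'I_N.+1,
    (0 +i* 1) * ((tnth w j - tnth v j) / dt%:C) + D2 dx (midstate v w) j +
    (nonlinearity sigma (normc (tnth w j)) (normc (tnth v j)))%:C *
      midstate v w j =
    eps%:C * (midstate v w j * (ftilde dt A x j)%:C).

(* F m v x is the value of u^{m+1} chosen when u^m = v and chi^{m+1/2} = x;   *)
(* it is None exactly when the scheme has no solution.                        *)
Definition mec_solver (R : realType) (N : nat) (sigma eps dx dt : R)
    (A : 'M[R]_N.+1)
    (F : nat -> state R N -> noise R N -> option (state R N)) : Prop :=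
  [/\ forall m v x w, F m v x = Some w -> mec_step sigma eps dx dt A v x w,
      forall m v x, F m v x = None ->
        forall w, ~ mec_step sigma eps dx dt A v x w &
      forall m (B : set (state R N)), measurable B ->
        measurable [set p : state R N * noise R N |
                     exists2 w, B w & F m p.1 p.2 = Some w]].

Definition mec_solution (R : realType) (N : nat) (sigma eps dx dt : R)
    (A : 'M[R]_N.+1) (Omega : Type) (chi : nat -> Omega -> noise R N)
    (u0 : state R N) (u : nat -> Omega -> option (state R N)) : Prop :=
  exists2 F, mec_solver sigma eps dx dt A F &
    forall w, u 0%N w = Some u0 /\
      forall m, u m.+1 w = obind (fun v => F m v (chi m w)) (u m w).

(* +oo if u^m w is defined for all m. *)
Definition existence_time (R : realType) (N : nat) (dt : R) (Omega : Type)
    (u : nat -> Omega -> option (state R N)) (w : Omega) : \bar R :=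
  ereal_inf [set (m%:R * dt)%:E | m in [set m | u m w = None]].

Definition mass (R : realType) (N : nat) (dx : R) (v : state R N) : R :=
  dx * \sum_j normc (tnth v j) ^+ 2.

Definition energy (R : realType) (N : nat) (sigma dx : R) (v : state R N) : R :=
  2^-1 * \sum_j normc ((tnth v (right_nb j) - tnth v j) / dx%:C) ^+ 2 * dx -
  (2 * (sigma + 1))^-1 * \sum_j normc (tnth v j) `^ (2 * (sigma + 1)) * dx.

(* Undefined states are sent to 0; they only occur on a null set when         *)
(* t_m < tau^* almost surely.                                                 *)
Definition oenergy (R : realType) (N : nat) (sigma dx : R)
    (v : option (state R N)) : R :=
  oapp (energy sigma dx) 0 v.

(* Main.v *)
Require Import Defs.
From HB Require Import structures.
From mathcomp Require Import all_boot all_order all_algebra.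
From mathcomp Require Import complex.
From mathcomp Require Import all_classical all_reals all_analysis.
From mathcomp Require Import measurable_realfun.
From mathcomp Require Import ring lra zify.

(** The scheme conserves the mass exactly: testing it against the conjugate of
    the midpoint state (v + w) / 2 and taking the imaginary part kills the
    Laplacian, the nonlinearity and the noise, whose contributions are real.
    Testing it against the conjugate of w - v and taking the real part kills the
    time difference instead, and the denominator of the nonlinear quotient
    cancels, so that the energy changes by
      H(w) - H(v) = - (eps / 2) dx sum_j f_j (|w_j|^2 - |v_j|^2),
    where f_j is the discretized noise: Gaussian, centered, of variance at most
    s^2 = delta^2 / dt.

    The current state v depends on the past noise only, hence is independent of
    f, and the terms f_j |v_j|^2 average to zero.  The numbers dx |w_j|^2 are
    nonnegative and sum to the conserved mass K, so the other terms are at most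
    K max_j (- f_j).  The maximum of n centered Gaussians of variance at most
    s^2 has mean at most s sqrt(2 ln n); here n = N + 1 <= 2 N = 4 Lc / dx,
    whence the logarithm of the statement.  Summing over the M steps gives the
    first bound.  For the second one, the sum over j is bounded pathwise, for
    each step, by K (max_j (- f_j) + max_j f_j), which is nonnegative: the sum
    of these quantities over all steps then bounds the energy at every time, and
    the price is twice the bound of one step.

    Only exponential moments of the noise enter.  The maximum is replaced by
    softmax, an affine function of sum_j exp(lam y_j) that dominates every y_j
    (le_softmax) and has the right mean for the optimal lam (softmax_mean).  The
    vanishing of the mean of f_j |v_j|^2 is replaced by t f_j <= exp(t f_j) - 1
    for small t > 0, the mean of the right side being O(t^2) by independence
    (weighted_mmt_gen_fun).  Every mean taken is thus that of a bounded
    variable, of an exponential of the noise, or of a product of nonnegative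
    independent variables (expectationM).  The independence of the state and the
    next noise (recursion_independent_total) is proved by induction along the
    recursion; the same lemma, applied to a random walk, yields the exponential
    moments of linear combinations of the noise components
    (gaussian_sum_mmt_gen_fun). *)

Set Implicit Arguments.
Unset Strict Implicit.
Unset Printing Implicit Defensive.

Import Order.TTheory GRing.Theory Num.Theory.
Import numFieldNormedType.Exports.
Import ComplexField.Normc.

Local Open Scope classical_set_scope.
Local Open Scope complex_scope.
Local Open Scope ring_scope.

(** * Conservation of the mass and increment of the energy *)

Lemma Re_mul_real (R : realType) (z : R[i]) (r : R) :
  complex.Re (z * r%:C) = complex.Re z * r.
Proof. by case: z => a b /=; rewrite mulr0 subr0. Qed.

Lemma Im_mul_real (R : realType) (z : R[i]) (r : R) :
  complex.Im (z * r%:C) = complex.Im z * r.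
Proof. by case: z => a b /=; rewrite mulr0 add0r. Qed.

Lemma Re_div_real (R : realType) (z : R[i]) (r : R) :
  complex.Re (z / r%:C) = complex.Re z / r.
Proof. by rewrite -fmorphV Re_mul_real. Qed.

Lemma Im_div_real (R : realType) (z : R[i]) (r : R) :
  complex.Im (z / r%:C) = complex.Im z / r.
Proof. by rewrite -fmorphV Im_mul_real. Qed.

Lemma normc_nonneg (R : realType) (z : R[i]) : 0 <= normc z.
Proof. by case: z => a b; exact: sqrtr_ge0. Qed.

Lemma normc_sqr (R : realType) (z : R[i]) :
  normc z ^+ 2 = complex.Re z ^+ 2 + complex.Im z ^+ 2.
Proof. by case: z => a b /=; rewrite sqr_sqrtr// addr_ge0// sqr_ge0. Qed.

Definition laplacian (R : realType) (N : nat) (f : 'I_N.+1 -> R) j : R :=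
  f (left_nb j) - 2 * f j + f (right_nb j).

Definition increment (R : realType) (N : nat) (f : 'I_N.+1 -> R) j : R :=
  f (right_nb j) - f j.

(** The Neumann pseudo-points make both boundary terms vanish, since the
    increment is zero at the last index. *)
Lemma summation_by_parts (R : realType) (N : nat) (f g : 'I_N.+1 -> R) :
  \sum_j laplacian f j * g j = - \sum_j increment f j * increment g j.
Proof.
pose F n := f (inord n); pose G n := g (inord n).
have inj (j : 'I_N.+1) : inord j = j by rewrite inord_val.
transitivity (\sum_(j < N.+1) (F j.-1 - 2 * F j + F (minn j.+1 N)) * G j).
  by apply: eq_bigr => j _; rewrite /laplacian /F /G inj.
transitivity (- \sum_(j < N.+1)
    (F (minn j.+1 N) - F j) * (G (minn j.+1 N) - G j)); last first.
  by congr (- _); apply: eq_bigr => j _; rewrite /increment /F /G !inj.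
have E : \sum_(j < N.+1) (F j.-1 - F j) * G j =
   - \sum_(j < N) (F j.+1 - F j) * G j.+1.
  rewrite big_ord_recl/= subrr mul0r add0r -sumrN.
  by apply: eq_bigr => j _; rewrite /bump /= add0n add1n; ring.
have E' (h : nat -> R) : \sum_(j < N.+1) (F (minn j.+1 N) - F j) * h j =
   \sum_(j < N) (F j.+1 - F j) * h j.
  rewrite big_ord_recr/= (minn_idPr (leqnSn N)) subrr mul0r addr0.
  by apply: eq_bigr => j _; rewrite (minn_idPl (ltn_ord j)).
rewrite (E' (fun j => G (minn j.+1 N) - G j)).
rewrite (eq_bigr (fun j : 'I_N.+1 =>
    (F j.-1 - F j) * G j + (F (minn j.+1 N) - F j) * G j)); last first.
  by move=> j _; ring.
rewrite big_split/= E (E' G) -!sumrN -big_split/=.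
by apply: eq_bigr => j _; rewrite (minn_idPl (ltn_ord j)); ring.
Qed.

(** Real and imaginary parts of the scheme; the rest of the analysis of a step
    is real. *)
Lemma mec_step_coords (R : realType) (N : nat) (sigma eps dx dt : R)
    (A : 'M[R]_N.+1) (v : state R N) (x : noise R N) (w : state R N) :
  mec_step sigma eps dx dt A v x w ->
  forall j,
  let a j := complex.Re (tnth v j) in let b j := complex.Im (tnth v j) in
  let c j := complex.Re (tnth w j) in let d j := complex.Im (tnth w j) in
  let p j := (a j + c j) / 2 in let q j := (b j + d j) / 2 in
  let nl := nonlinearity sigma (normc (tnth w j)) (normc (tnth v j)) in
  - ((d j - b j) / dt) + laplacian p j / dx ^+ 2 + nl * p j =
     eps * ftilde dt A x j * p j /\
  (c j - a j) / dt + laplacian q j / dx ^+ 2 + nl * q j =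
     eps * ftilde dt A x j * q j.
Proof.
move=> + j a b c d p q nl => /(_ j); rewrite -/nl => H.
have two : (2 : R[i]) = 2%:C by rewrite rmorph_nat.
have Rm k : complex.Re (midstate v w k) = p k.
  by rewrite /midstate two Re_div_real raddfD.
have Im k : complex.Im (midstate v w k) = q k.
  by rewrite /midstate two Im_div_real raddfD.
have RI (z : R[i]) : complex.Re ((0 +i* 1) * z) = - complex.Im z.
  by case: z => ? ? /=; ring.
have II (z : R[i]) : complex.Im ((0 +i* 1) * z) = complex.Re z.
  by case: z => ? ? /=; ring.
have RD : complex.Re (D2 dx (midstate v w) j) = laplacian p j / dx ^+ 2.
  rewrite /D2 Re_div_real !raddfD raddfN/= two [_%:C * _]mulrC Re_mul_real !Rm.
  by rewrite /laplacian [2 * _]mulrC.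
have ID : complex.Im (D2 dx (midstate v w) j) = laplacian q j / dx ^+ 2.
  rewrite /D2 Im_div_real !raddfD raddfN/= two [_%:C * _]mulrC Im_mul_real !Im.
  by rewrite /laplacian [2 * _]mulrC.
split.
  move: (congr1 (@complex.Re R) H).
  rewrite !raddfD/= RI Im_div_real raddfB/= RD [_%:C * midstate _ _ _]mulrC.
  rewrite [eps%:C * _]mulrC !Re_mul_real !Rm /a /b /c /d => e.
  by rewrite [nl * _]mulrC e; ring.
move: (congr1 (@complex.Im R) H).
rewrite !raddfD/= II Re_div_real raddfB/= ID [_%:C * midstate _ _ _]mulrC.
rewrite [eps%:C * _]mulrC !Im_mul_real !Im /a /b /c /d => e.
by rewrite [nl * _]mulrC e; ring.
Qed.

(** Pairing the two real equations with (- q, p), where p + i q is the midpoint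
    state, leaves the difference of the squared moduli and a Laplacian term that
    sums to zero because the Laplacian is symmetric. *)
Lemma mass_conservation (R : realType) (N : nat) (sigma eps dx dt : R)
    (A : 'M[R]_N.+1) (v : state R N) (x : noise R N) (w : state R N) :
  dt != 0 -> mec_step sigma eps dx dt A v x w -> mass dx w = mass dx v.
Proof.
move=> dt0 /mec_step_coords H; congr (_ * _).
pose a j := complex.Re (tnth v j); pose b j := complex.Im (tnth v j).
pose c j := complex.Re (tnth w j); pose d j := complex.Im (tnth w j).
pose p j := (a j + c j) / 2; pose q j := (b j + d j) / 2.
have e j : normc (tnth w j) ^+ 2 - normc (tnth v j) ^+ 2 =
    2 * dt / dx ^+ 2 * (laplacian p j * q j - laplacian q j * p j).
  have [e1 e2] := H j; rewrite !normc_sqr.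
  move: e1 e2; rewrite -/(a j) -/(b j) -/(c j) -/(d j) -/(p j) -/(q j).
  set nl := nonlinearity _ _ _; set f := ftilde _ _ _ _.
  rewrite -[fun j => (a j + c j) / 2]/p -[fun j => (b j + d j) / 2]/q => e1 e2.
  have /(congr1 (fun z => z * dt)) :
    (c j - a j) / dt * p j + (d j - b j) / dt * q j =
     (laplacian p j * q j - laplacian q j * p j) / dx ^+ 2.
    rewrite (_ : (c j - a j) / dt =
      eps * f * q j - laplacian q j / dx ^+ 2 - nl * q j); last first.
      by rewrite -e2; ring.
    rewrite (_ : (d j - b j) / dt =
      laplacian p j / dx ^+ 2 + nl * p j - eps * f * p j); last first.
      by rewrite -e1; ring.
    ring.
  rewrite (_ : (_ + _) * dt = (c j - a j) * p j + (d j - b j) * q j); last by field.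
  move=> e3; rewrite (_ : _ - _ = 2 * ((c j - a j) * p j + (d j - b j) * q j)).
    by rewrite e3; ring.
  by rewrite /p /q; field.
apply/eqP; rewrite -subr_eq0 -sumrB; apply/eqP.
rewrite (eq_bigr _ (fun j _ => e j)) -mulr_sumr sumrB !summation_by_parts.
rewrite (_ : _ - _ = 0) ?mulr0//; apply/eqP; rewrite subr_eq0; apply/eqP.
by congr (- _); apply: eq_bigr => j _; rewrite mulrC.
Qed.

(** The quotient was designed for this product; it is consistent with the value
    on the diagonal because both sides vanish there. *)
Lemma nonlinearityM (R : realType) (sigma a b : R) : 0 <= a -> 0 <= b ->
  nonlinearity sigma a b * (a ^+ 2 - b ^+ 2) =
  (sigma + 1)^-1 * (a `^ (2 * (sigma + 1)) - b `^ (2 * (sigma + 1))).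
Proof.
move=> a0 b0; rewrite /nonlinearity; case: eqVneq => [->|ab].
  by rewrite !subrr !mulr0.
rewrite -mulrA divfK// subr_eq0; apply: contra ab.
by rewrite eqrXn2.
Qed.

(** Pairing the two real equations with the real and imaginary parts of w - v:
    the time differences cancel, the Laplacian gives the increment of the
    gradient part of the energy and nonlinearityM that of the power part. *)
Lemma energy_increment (R : realType) (N : nat) (sigma eps dx dt : R)
    (A : 'M[R]_N.+1) (v : state R N) (x : noise R N) (w : state R N) :
  mec_step sigma eps dx dt A v x w ->
  energy sigma dx w - energy sigma dx v =
  - (eps / 2) * (dx * \sum_j ftilde dt A x j *
     (normc (tnth w j) ^+ 2 - normc (tnth v j) ^+ 2)).
Proof.
move=> /mec_step_coords H.
pose a j := complex.Re (tnth v j); pose b j := complex.Im (tnth v j).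
pose c j := complex.Re (tnth w j); pose d j := complex.Im (tnth w j).
pose p j := (a j + c j) / 2; pose q j := (b j + d j) / 2.
pose r j := c j - a j; pose s j := d j - b j.
pose V j := normc (tnth v j) `^ (2 * (sigma + 1)).
pose W j := normc (tnth w j) `^ (2 * (sigma + 1)).
have e j : eps * (ftilde dt A x j *
     (normc (tnth w j) ^+ 2 - normc (tnth v j) ^+ 2)) =
    2 / dx ^+ 2 * (laplacian p j * r j + laplacian q j * s j) +
    (sigma + 1)^-1 * (W j - V j).
  have [e1 e2] := H j.
  rewrite -nonlinearityM ?normc_nonneg// !normc_sqr.
  move: e1 e2; rewrite -/(a j) -/(b j) -/(c j) -/(d j) -/(p j) -/(q j).
  set nl := nonlinearity _ _ _; set f := ftilde _ _ _ _.
  rewrite -[fun j => (a j + c j) / 2]/p -[fun j => (b j + d j) / 2]/q => e1 e2.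
  have E : c j ^+ 2 + d j ^+ 2 - (a j ^+ 2 + b j ^+ 2) =
      2 * (p j * r j + q j * s j).
    by rewrite /p /q /r /s; field.
  rewrite E //.
  transitivity (2 * ((eps * f * p j) * r j + (eps * f * q j) * s j)).
    by ring.
  by rewrite -e1 -e2 /r /s; ring.
have gradE (z : state R N) :
   \sum_j normc ((tnth z (right_nb j) - tnth z j) / dx%:C) ^+ 2 =
   dx ^- 2 * \sum_j (increment (fun j => complex.Re (tnth z j)) j ^+ 2 +
             increment (fun j => complex.Im (tnth z j)) j ^+ 2).
  rewrite mulr_sumr; apply: eq_bigr => j _.
  by rewrite normc_sqr Re_div_real Im_div_real !raddfB/= !expr_div_n /increment; ring.
have gradB : \sum_j (laplacian p j * r j + laplacian q j * s j) = - (2^-1 *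
  (\sum_j (increment c j ^+ 2 + increment d j ^+ 2) -
   \sum_j (increment a j ^+ 2 + increment b j ^+ 2))).
  rewrite big_split/= !summation_by_parts -opprD -big_split/= -sumrB mulr_sumr.
  by congr (- _); apply: eq_bigr => j _; rewrite /increment /p /q /r /s; field.
rewrite /energy -!mulr_suml !gradE.
set GW := \sum_j (increment _ j ^+ 2 + _).
set GV := \sum_j (increment _ j ^+ 2 + _).
rewrite (_ : - (eps / 2) * (dx * _) =
  - (dx / 2) * (eps * (\sum_j ftilde dt A x j *
     (normc (tnth w j) ^+ 2 - normc (tnth v j) ^+ 2)))); last by ring.
rewrite mulr_sumr (eq_bigr _ (fun j _ => e j)) big_split/= -!mulr_sumr sumrB gradB.
rewrite -/GW -/GV (_ : (2 * (sigma + 1))^-1 = 2^-1 * (sigma + 1)^-1);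
  last by rewrite invfM.
set SW := \sum_(i < _) normc (tnth w _) `^ _.
set SV := \sum_(i < _) normc (tnth v _) `^ _.
move: (sigma + 1)^-1 (dx ^- 2) => s' h.
by field.
Qed.

(** * Independence along a noise-driven recursion *)

(** States are partial because the scheme may fail to have a solution. *)
Definition in_state (Omega T : Type) (y : Omega -> option T) (B : set T) :
    set Omega :=
  [set w | exists2 v, B v & y w = Some v].

Definition partial_measurable d (Omega : measurableType d) dT
    (T : measurableType dT) (y : Omega -> option T) : Prop :=
  forall B, measurable B -> measurable (in_state y B).

Lemma in_state_odflt (Omega T : Type) (y : Omega -> option T) (t0 : T) B :
  in_state y B = in_state y setT `&` (fun w => odflt t0 (y w)) @^-1` B.
Proof.
apply/seteqP; split => w /=.
  by case=> v Bv yv; split; [exists v|rewrite yv].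
by case=> -[v _ yv]; rewrite yv /= => Bv; exists v.
Qed.

Lemma measurable_oapp d (Omega : measurableType d) dT (T : measurableType dT)
    dS (S : measurableType dS) (y : Omega -> option T) (f : T -> S) (s0 : S) :
  partial_measurable y -> measurable_fun setT f ->
  measurable_fun setT (fun w => oapp f s0 (y w)).
Proof.
move=> my mf _ B mB; rewrite setTI.
have mfB : measurable (f @^-1` B) by rewrite -[X in measurable X]setTI; exact: mf.
have [Bs|Bs] := pselect (B s0).
  rewrite (_ : _ @^-1` _ = in_state y (f @^-1` B) `|` ~` in_state y setT).
    by apply: measurableU; [exact: my|apply: measurableC; exact: my].
  apply/seteqP; split => w /=.
    case E : (y w) => [v|] /= Bv; first by left; exists v.
    by right => -[v _]; rewrite E.
  case=> [[v Bv ->]//|]; case E : (y w) => [v|]//= Hv.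
  by exfalso; apply: Hv; exists v; rewrite ?E.
rewrite (_ : _ @^-1` _ = in_state y (f @^-1` B)); first exact: my.
apply/seteqP; split => w /=; last by case=> v Bv ->.
by case E : (y w) => [v|] //= Bv; exists v.
Qed.

(** A partial state becomes an ordinary random variable once a default value
    stands for the undefined one. *)
Lemma measurable_odflt d (Omega : measurableType d) dT (T : measurableType dT)
    (y : Omega -> option T) (t0 : T) :
  partial_measurable y -> measurable_fun setT (fun w => odflt t0 (y w)).
Proof. by move=> my; exact: measurable_oapp. Qed.

(** The product rule along an enumeration f of finitely many indices, which
    allows an index set other than nat; g recovers the position of an index. *)
Lemma mutually_independent_iota d (Omega : measurableType d) (R : realType)
    (P : probability Omega R) (I : eqType) dS (S : measurableType dS)
    (X : I -> Omega -> S) (n : nat) (f : nat -> I) (g : I -> nat)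
    (B : nat -> set S) :
  (forall i, measurable_fun setT (X i)) -> mutually_independent P X ->
  (forall i, (i < n)%N -> g (f i) = i) -> (forall i, measurable (B i)) ->
  P [set w | forall i, (i < n)%N -> B i (X (f i) w)] =
  (\prod_(i < n) fine (P (X (f i) @^-1` B i)))%:E.
Proof.
move=> mX iX gf mB.
set E := mkset _.
have mE : measurable E.
  rewrite (_ : E = \bigcap_(i in [set i | (i < n)%N]) (X (f i) @^-1` B i))//.
  apply: bigcap_measurableType => i _.
  rewrite -[X in measurable X]setTI; exact: mX.
have uJ : uniq [seq f i | i <- iota 0 n].
  rewrite map_inj_in_uniq ?iota_uniq// => i j; rewrite !mem_iota !add0n => hi hj fij.
  by rewrite -(gf i)// -(gf j)// fij.
have := iX _ (fun i => B (g i)) uJ (fun i => mB (g i)).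
rewrite big_map (_ : iota 0 n = index_iota 0 n) ?big_mkord; last first.
  by rewrite /index_iota subn0.
rewrite (_ : mkset _ = E) => [EE|].
  rewrite -(fineK (fin_num_measure P _ mE)); congr EFin; rewrite EE.
  by apply: eq_bigr => i _; rewrite gf.
apply/seteqP; split => w H i.
  move=> hi; have := H (f i); rewrite gf//; apply.
  by apply: map_f; rewrite mem_index_iota.
by case/mapP => k; rewrite mem_index_iota => hk ->; rewrite gf//; exact: H.
Qed.

(** Partial states let one result cover the scheme, whose state may be
    undefined, and random walks.  Independence up to a fixed n suits both
    infinite sequences and the components of one noise vector. *)
Section recursion.
Context d (Omega : measurableType d) (R : realType) (P : probability Omega R).
Context dT (T : measurableType dT) dS (S : measurableType dS).
Variables (X : nat -> Omega -> S) (Y : nat -> Omega -> option T).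
Variables (F : nat -> T -> S -> option T) (y0 : T) (n : nat).
Hypothesis mX : forall i, measurable_fun setT (X i).
Hypothesis X_indep : forall B : nat -> set S, (forall i, measurable (B i)) ->
  P [set w | forall i, (i < n)%N -> B i (X i w)] =
  (\prod_(i < n) fine (P (X i @^-1` B i)))%:E.
Hypothesis Y0 : forall w, Y 0%N w = Some y0.
Hypothesis YS : forall m w, Y m.+1 w = obind (fun v => F m v (X m w)) (Y m w).
Hypothesis mF : forall m B, measurable B ->
  measurable [set p : T * S | exists2 v, B v & F m p.1 p.2 = Some v].

Let W m w := (odflt y0 (Y m w), X m w).

Let in_stateS m B : in_state (Y m.+1) B =
  in_state (Y m) setT `&`
  W m @^-1` [set p : T * S | exists2 v, B v & F m p.1 p.2 = Some v].
Proof.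
apply/seteqP; split => w; rewrite /in_state /= YS.
  case=> v Bv; case E : (Y m w) => [v'|]//= Fv.
  by split; [exists v'|exists v].
by case=> -[v' _ E]; rewrite /W E /= => -[v Bv Fv]; exists v.
Qed.

Let measurable_W m : partial_measurable (Y m) -> measurable_fun setT (W m).
Proof. by move=> mY; apply: measurable_fun_pair => //; exact: measurable_odflt. Qed.

Lemma recursion_measurable m : partial_measurable (Y m).
Proof.
elim: m => [|m IH] B mB.
  have [Bt|Bt] := pselect (B y0).
    rewrite (_ : in_state _ _ = setT)//; apply/seteqP; split => // w _.
    by exists y0; rewrite ?Y0.
  rewrite (_ : in_state _ _ = set0)//; apply/seteqP; split => // w [v Bv].
  by rewrite Y0 => -[?]; subst v.
rewrite in_stateS; apply: measurableI; first exact: IH.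
rewrite -[X in measurable X]setTI; apply: measurable_W => //.
exact: mF.
Qed.

Let tail m (D : nat -> set S) :=
  [set w | forall i, (m <= i < n)%N -> D i (X i w)].

Let measurable_tail m D : (forall i, measurable (D i)) -> measurable (tail m D).
Proof.
move=> mD; rewrite (_ : tail m D =
  \bigcap_(i in [set i | (m <= i < n)%N]) (X i @^-1` D i))//.
apply: bigcap_measurableType => i _.
rewrite -[X in measurable X]setTI; exact: mX.
Qed.

Let tailS m D : (m < n)%N -> tail m D = X m @^-1` D m `&` tail m.+1 D.
Proof.
move=> mn; apply/seteqP; split => w.
  move=> H; split; first by apply: H; rewrite leqnn.
  by move=> i /andP[mi i_n]; apply: H; rewrite i_n ltnW.
case=> Hm H i /andP[]; rewrite leq_eqVlt => /orP[/eqP <-//|mi i_n].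
by apply: H; rewrite mi.
Qed.

Let Pfin (A : set Omega) : measurable A -> P A = (fine (P A))%:E.
Proof. by move=> mA; rewrite fineK// fin_num_measure. Qed.

(** Induction on m.  The state Y_(m+1) is a function of (Y_m, X_m); on
    rectangles the pair is independent of the later noise by the induction
    hypothesis, with X_m moved from the tail to the pair.  Rectangles generate
    the product sigma-algebra, so two finite measures compare on all measurable
    sets. *)
Lemma recursion_independent_tail m B (D : nat -> set S) : (m <= n)%N ->
  measurable B -> (forall i, measurable (D i)) ->
  P (in_state (Y m) B `&` tail m D) =
  (P (in_state (Y m) B) * (\prod_(m <= i < n) fine (P (X i @^-1` D i)))%:E)%E.
Proof.
elim: m B D => [|m IH] B D mn mB mD.
  have tailE : P (tail 0 D) = (\prod_(0 <= i < n) fine (P (X i @^-1` D i)))%:E.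
    by rewrite big_mkord -X_indep.
  have [Bt|Bt] := pselect (B y0).
    rewrite (_ : in_state _ _ = setT) ?setTI ?probability_setT ?mul1e//.
    by apply/seteqP; split => // w _; exists y0; rewrite ?Y0.
  rewrite (_ : in_state _ _ = set0) ?set0I ?measure0 ?mul0e//.
  by apply/seteqP; split => // w [v Bv]; rewrite Y0 => -[?]; subst v.
set c := \prod_(_ <= i < _) _.
have c0 : 0 <= c by apply: prodr_ge0 => i _; exact: fine_ge0.
pose Def := in_state (Y m) setT.
have mDef : measurable Def by exact: recursion_measurable.
have mE : measurable (Def `&` tail m.+1 D).
  by apply: measurableI => //; exact: measurable_tail.
have mW := measurable_W (@recursion_measurable m).
pose push (Q : {measure set Omega -> \bar R}) : {measure set (T * S) -> \bar R} :=
  pushforward Q (W m).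
(* Both measures live on the pairs (state, noise) at time m: m1 keeps the
   constraint on the later noise, m2 replaces it by its probability c. *)
pose m1 := push mW (mrestr P mE).
pose m2 : {measure set (T * S) -> \bar R} :=
  mscale (NngNum c0) (push mW (mrestr P mDef)).
have rect A C : measurable A -> measurable C -> m1 (A `*` C) = m2 (A `*` C).
  move=> mA mC; pose D1 C' i := if (i == m)%N then C else C' i.
  have mD1 C' i : (forall i, measurable (C' i)) -> measurable (D1 C' i).
    by move=> mC'; rewrite /D1; case: ifP.
  have key C' : (forall i, measurable (C' i)) ->
    P ((W m @^-1` (A `*` C)) `&` (Def `&` tail m.+1 C')) =
    (P (in_state (Y m) A) * (fine (P (X m @^-1` C)) *
       \prod_(m.+1 <= i < n) fine (P (X i @^-1` C' i)))%:E)%E.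
    move=> mC'.
    transitivity (P (in_state (Y m) A `&` tail m (D1 C'))).
      congr (P _); rewrite (tailS _ mn) /D1 eqxx [in RHS](in_state_odflt _ y0 A).
      rewrite (_ : tail m.+1 (fun i => _) = tail m.+1 C'); last first.
        apply/seteqP; split => w H i /[dup] hi /H; rewrite (_ : (i == m) = false)//;
        by apply/negbTE; lia.
      by rewrite /Def; apply/seteqP; split => w /=; rewrite /W /=; tauto.
    rewrite IH//; [|exact: ltnW|by move=> i; exact: mD1].
    congr (_ * _%:E)%E; rewrite big_ltn// /D1 eqxx; congr (_ * _).
    by apply: eq_big_nat => i hi; rewrite (_ : (i == m) = false)//; apply/negbTE; lia.
  rewrite /m1 /m2 /= /mscale /= /pushforward /mrestr /= key//.
  have -> : P (W m @^-1` (A `*` C) `&` Def) =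
     P (W m @^-1` (A `*` C) `&` (Def `&` tail m.+1 (fun=> setT))).
    congr (P (_ `&` _)); rewrite (_ : tail _ _ = setT) ?setIT//.
    by apply/seteqP; split.
  rewrite key//.
  rewrite [X in (_ * (_ * X)%:E)%E = _](_ : _ = c)//.
  rewrite [X in (_ * (_ * (_ * X)%:E))%E](_ : _ = 1).
    by rewrite mulr1 EFinM muleA muleC.
  by apply: big1 => i _; rewrite preimage_setT probability_setT.
rewrite in_stateS -setIA setICA.
pose G : set (set (T * S)) :=
  [set C | exists A, measurable A /\ exists B, measurable B /\ C = A `*` B].
have GI : setI_closed G.
  move=> /= _ _ [X1 [mX1 [X2 [mX2 ->]]]] [Y1 [mY1 [Y2 [mY2 ->]]]].
  rewrite -setXI; exists (X1 `&` Y1); split; first exact: measurableI.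
  by exists (X2 `&` Y2); split => //; exact: measurableI.
have GT : G setT by exists setT; split => //; exists setT; split; rewrite ?setXTT.
have /= := @measure_unique _ R _ G (fun=> setT) _ GI (fun=> GT) _ m1 m2
  _ _ _ (mF m mB).
rewrite /m1 /m2 /= /mscale /= /pushforward /mrestr /= => ->.
- by rewrite muleC setIC.
- rewrite measurable_prod_measurableType //; congr (<<s _ >>).
  rewrite predeqE; split => [[A mA [C mC <-]]|[A [mA [C [mC ->]]]]].
    by exists A; split => //; exists C.
  by exists A => //; exists C.
- by apply/seteqP; split => // x _; exists 0%N.
- by move=> _ [A [mA [C [mC ->]]]]; exact: rect.
- by move=> _; rewrite preimage_setT setTI (le_lt_trans (probability_le1 _ _)) ?ltry.
Qed.

(** Later noises are left unconstrained. *)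
Lemma recursion_independent m B D : (m < n)%N -> measurable B -> measurable D ->
  P (in_state (Y m) B `&` X m @^-1` D) =
  (P (in_state (Y m) B) * P (X m @^-1` D))%E.
Proof.
move=> mn mB mD.
pose D' i := if (i == m)%N then D else setT.
have mD' i : measurable (D' i) by rewrite /D'; case: ifP.
have := recursion_independent_tail (ltnW mn) mB mD'.
rewrite tailS// {1}/D' eqxx (_ : tail m.+1 D' = setT); last first.
  by apply/seteqP; split => // w _ i hi; rewrite /D' (_ : (i == m) = false)//;
    apply/negbTE; lia.
rewrite setIT => ->; congr (_ * _)%E.
rewrite big_ltn// big_nat_cond big1; last first.
  move=> i hi; rewrite /D' (_ : (i == m) = false) ?preimage_setT ?probability_setT//.
  by apply/negbTE; lia.
rewrite mulr1 /D' eqxx -Pfin// -[X in measurable X]setTI; exact: mX.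
Qed.

(** If the default value y0 lies in B, the complement of the event says that the
    partial state is defined outside of B. *)
Lemma recursion_independent_total m B D : (m < n)%N ->
  measurable B -> measurable D ->
  P ((fun w => odflt y0 (Y m w)) @^-1` B `&` X m @^-1` D) =
  (P ((fun w => odflt y0 (Y m w)) @^-1` B) * P (X m @^-1` D))%E.
Proof.
move=> mn mB mD; have mY := @recursion_measurable m.
have mV C : measurable C -> measurable ((fun w => odflt y0 (Y m w)) @^-1` C).
  by move=> mC; rewrite -[X in measurable X]setTI; exact: measurable_odflt.
have mXD : measurable (X m @^-1` D).
  by rewrite -[X in measurable X]setTI; exact: mX.
have [By|By] := pselect (B y0); last first.
  rewrite (_ : _ @^-1` B = in_state (Y m) B); first exact: recursion_independent.
  apply/seteqP; split => w /=; last by case=> v Bv ->.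
  by case E : (Y m w) => [v|] //= Bv; exists v.
have -> : (fun w => odflt y0 (Y m w)) @^-1` B = ~` in_state (Y m) (~` B).
  apply/seteqP; split => w /=.
    by move=> + [v Bv E]; rewrite E.
  case E : (Y m w) => [v|] //= H; apply: contrapT => nB; apply: H.
  by exists v.
have mI : measurable (in_state (Y m) (~` B)) by apply: mY; exact: measurableC.
rewrite probability_setC// setIC -setDE measureD//; last first.
  by rewrite ltey_eq fin_num_measure.
have I2 := recursion_independent mn (measurableC mB) mD.
rewrite setIC in I2.
transitivity (P (X m @^-1` D) - P (in_state (Y m) (~` B)) * P (X m @^-1` D))%E.
  by rewrite -I2.
rewrite (Pfin mI) (Pfin mXD) -EFinM -[1%E]/(1%:E) -!EFinB -EFinM; congr EFin; ring.
Qed.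

End recursion.

(** The joint law is the product of the laws, and Tonelli's theorem splits the
    integral. *)
Lemma expectationM d (Omega : measurableType d) (R : realType)
    (P : probability Omega R) dT (T : measurableType dT) dS
    (S : measurableType dS) (X : Omega -> T) (Z : Omega -> S)
    (f : T -> R) (g : S -> R) :
  measurable_fun setT X -> measurable_fun setT Z ->
  (forall B C, measurable B -> measurable C ->
    P (X @^-1` B `&` Z @^-1` C) = P (X @^-1` B) * P (Z @^-1` C))%E ->
  measurable_fun setT f -> measurable_fun setT g ->
  (forall x, 0 <= f x) -> (forall z, 0 <= g z) ->
  (\int[P]_w (f (X w) * g (Z w))%:E =
   \int[P]_w (f (X w))%:E * \int[P]_w (g (Z w))%:E)%E.
Proof.
move=> mX mZ XZ mf mg f0 g0.
pose X' : {RV P >-> T} := HB.pack X (isMeasurableFun.Build _ _ _ _ _ mX).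
pose Z' : {RV P >-> S} := HB.pack Z (isMeasurableFun.Build _ _ _ _ _ mZ).
have mXZ : measurable_fun setT (fun w => (X w, Z w)).
  by apply: measurable_fun_pair.
pose V : {RV P >-> (T * S)%type} :=
  HB.pack (fun w => (X w, Z w)) (isMeasurableFun.Build _ _ _ _ _ mXZ).
pose F (p : T * S) := (f p.1 * g p.2)%:E.
have mF : measurable_fun setT F.
  apply/measurable_EFinP; apply: measurable_funM.
    exact: (measurableT_comp mf).
  exact: (measurableT_comp mg).
have F0 p : (0 <= F p)%E by rewrite lee_fin mulr_ge0.
have mfE : measurable_fun setT (EFin \o f) by exact/measurable_EFinP.
have mgE : measurable_fun setT (EFin \o g) by exact/measurable_EFinP.
rewrite -[LHS](ge0_integral_distribution V mF)//.
transitivity (\int[(distribution P X' \x distribution P Z')]_z F z)%E.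
  apply: eq_measure_integral => A mA _; apply/esym.
  by apply: product_measure_unique => // B C mB mC; exact: XZ.
rewrite fubini_tonelli1// /fubini_F/=.
rewrite -[X in (X * _)%E](ge0_integral_distribution X' mfE); last first.
  by move=> x; rewrite lee_fin.
rewrite -[X in (_ * X)%E](ge0_integral_distribution Z' mgE); last first.
  by move=> x; rewrite lee_fin.
transitivity (\int[distribution P X']_x
    ((f x)%:E * \int[distribution P Z']_y (g y)%:E))%E.
  apply: eq_integral => x _; rewrite -ge0_integralZl//.
    by move=> y _; rewrite lee_fin.
  by rewrite lee_fin.
rewrite ge0_integralZr//; first by move=> x _; rewrite lee_fin.
by apply: integral_ge0 => y _; rewrite lee_fin.
Qed.

(** * Exponential moments of Gaussian variables *)

(** The normal density is a version of the Radon-Nikodym derivative. *)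
Lemma ge0_integral_normal_prob (R : realType) (m s : R) (f : R -> \bar R) :
  measurable_fun setT f -> (forall x, 0 <= f x)%E ->
  (\int[normal_prob m s]_x f x =
   \int[lebesgue_measure]_x (f x * (normal_pdf m s x)%:E))%E.
Proof.
move=> mf f0.
have dom := @normal_prob_dominates R m s.
have mpdf : measurable_fun [set: R] (fun x => (normal_pdf m s x)%:E).
  by apply/measurable_EFinP; exact: measurable_normal_pdf.
have iRN := Radon_Nikodym_SigmaFinite.f_integrable dom.
rewrite -(Radon_Nikodym_SigmaFinite.change_of_variables dom)//.
apply: ae_eq_integral => //.
- by apply: emeasurable_funM => //; exact: measurable_int iRN.
- exact: emeasurable_funM.
- apply: ae_eqe_mul2l; apply: integral_ae_eq => //.
  by move=> E _ mE; rewrite -Radon_Nikodym_SigmaFinite.f_integral.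
Qed.

(** Completing the square: tilting N(0,1) by exp(a x) gives, up to the factor
    exp(a^2/2), the density of N(a,1). *)
Lemma normal_mmt_gen_fun (R : realType) (a : R) :
  (\int[normal_prob 0 1]_x (expR (a * x))%:E = (expR (a ^+ 2 / 2))%:E)%E.
Proof.
have mexp : measurable_fun [set: R] (fun x => (expR (a * x))%:E).
  apply/measurable_EFinP; exact: measurableT_comp.
rewrite (@ge0_integral_normal_prob _ 0 1 (fun x => (expR (a * x))%:E))//.
transitivity (\int[lebesgue_measure]_x
    ((expR (a ^+ 2 / 2))%:E * (normal_pdf a 1 x)%:E))%E.
  apply: eq_integral => x _; rewrite -!EFinM !normal_pdfE ?oner_neq0//; congr EFin.
  rewrite mulrCA [RHS]mulrCA; congr (_ * _).
  by rewrite /normal_fun -!expRD; congr expR; rewrite !expr1n; field.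
rewrite ge0_integralZl//.
- by rewrite integral_normal_pdf mule1.
- by apply/measurable_EFinP; exact: measurable_normal_pdf.
- by move=> x _; rewrite lee_fin normal_pdf_ge0.
Qed.

Definition standard_normal d (Omega : measurableType d) (R : realType)
    (P : probability Omega R) (X : Omega -> R) : Prop :=
  forall B : set R, measurable B -> P (X @^-1` B) = normal_prob 0 1 B.

Lemma standard_normal_mmt_gen_fun d (Omega : measurableType d) (R : realType)
    (P : probability Omega R) (X : Omega -> R) (a : R) :
  measurable_fun setT X -> standard_normal P X ->
  (\int[P]_w (expR (a * X w))%:E = (expR (a ^+ 2 / 2))%:E)%E.
Proof.
move=> mX nX.
have mX' : measurable_fun setT (X : Omega -> measurableTypeR R).
  by move=> ? B mB; exact: mX.
pose X' : {RV P >-> measurableTypeR R} :=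
  HB.pack (X : Omega -> measurableTypeR R)
    (isMeasurableFun.Build _ _ _ _ _ mX').
have mexp : measurable_fun [set: measurableTypeR R]
    (fun x : measurableTypeR R => (expR (a * (x : R)))%:E).
  apply/measurable_EFinP; exact: measurableT_comp.
rewrite -[LHS](ge0_integral_distribution X' mexp)//.
rewrite -normal_mmt_gen_fun; apply: eq_measure_integral => B mB _.
exact: nX.
Qed.

(** The partial sums form a recursion driven by the summands, so each partial
    sum is independent of the next summand. *)
Lemma gaussian_sum_mmt_gen_fun d (Omega : measurableType d) (R : realType)
    (P : probability Omega R) (X : nat -> Omega -> R) (n : nat) (a : nat -> R) :
  (forall i, measurable_fun setT (X i)) ->
  (forall B : nat -> set R, (forall i, measurable (B i)) ->
    P [set w | forall i, (i < n)%N -> B i (X i w)] =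
    (\prod_(i < n) fine (P (X i @^-1` B i)))%:E) ->
  (forall i, standard_normal P (X i)) ->
  forall m, (m <= n)%N ->
  (\int[P]_w (expR (\sum_(i < m) a i * X i w))%:E =
   (expR (\sum_(i < m) a i ^+ 2 / 2))%:E)%E.
Proof.
move=> mX iX nX; pose Y m w := Some (\sum_(i < m) a i * X i w).
pose F m (v x : R) := Some (v + a m * x).
have mF m (B : set R) : measurable B ->
    measurable [set p : R * R | exists2 v, B v & F m p.1 p.2 = Some v].
  move=> mB; rewrite (_ : mkset _ = (fun p : R * R => p.1 + a m * p.2) @^-1` B).
    rewrite -[X in measurable X]setTI; apply: measurable_funD => //.
    exact: measurable_funM.
  apply/seteqP; split => p /=; [by case=> v Bv [->]|move=> Bp].
  by exists (p.1 + a m * p.2).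
have YS m w : Y m.+1 w = obind (fun v => F m v (X m w)) (Y m w).
  by rewrite /Y /F /= big_ord_recr.
have Y0 w : Y 0%N w = Some 0 by rewrite /Y big_ord0.
have mS m : measurable_fun setT (fun w => \sum_(i < m) a i * X i w).
  by apply: measurable_sum => i; exact: measurable_funM.
elim=> [|m IH] mn.
  under eq_integral do rewrite big_ord0 expR0.
  by rewrite big_ord0 expR0 integral_cst//= probability_setT mule1.
under eq_integral do rewrite big_ord_recr/= expRD.
rewrite (@expectationM _ _ _ P _ _ _ _ (fun w => \sum_(i < m) a i * X i w) (X m)
  expR (fun x => expR (a m * x)))//.
- rewrite IH ?(ltnW mn)// standard_normal_mmt_gen_fun// -EFinM big_ord_recr/=.
  by rewrite expRD.
- by move=> B C mB mC; exact: (recursion_independent_total mX iX Y0 YS mF mn mB mC).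
- exact: measurableT_comp.
Qed.

Lemma gaussian_noise_mmt_gen_fun d (Omega : measurableType d) (R : realType)
    (P : probability Omega R) (N : nat) (chi : nat -> Omega -> noise R N) m
    (a : 'I_N.+1 -> R) : gaussian_noise P chi ->
  (\int[P]_w (expR (\sum_i a i * tnth (chi m w) i))%:E =
   (expR (\sum_i a i ^+ 2 / 2))%:E)%E.
Proof.
case=> mchi _ /(_ m) ichi /(_ m) nchi.
pose X i w := tnth (chi m w) (inord i).
have mX i : measurable_fun setT (X i).
  by have /measurable_fun_tnthP := mchi m; apply.
have iX (B : nat -> set R) : (forall i, measurable (B i)) ->
    P [set w | forall i, (i < N.+1)%N -> B i (X i w)] =
    (\prod_(i < N.+1) fine (P (X i @^-1` B i)))%:E.
  apply: (mutually_independent_iota (g := @nat_of_ord N.+1) _ ichi) => [i|i hi].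
    by have /measurable_fun_tnthP := mchi m; apply.
  exact: inordK.
have nX i : standard_normal P (X i) by move=> B mB; exact: nchi.
transitivity (\int[P]_w (expR (\sum_(i < N.+1) a (inord i) * X i w))%:E)%E.
  apply: eq_integral => w _; congr (expR _)%:E; apply: eq_bigr => i _.
  by rewrite /X inord_val.
rewrite (gaussian_sum_mmt_gen_fun (fun i => a (inord i)) mX iX nX (leqnn _)).
by congr (expR _)%:E; apply: eq_bigr => i _; rewrite inord_val.
Qed.

(** * Means of integrable variables *)

(** Integrability and value together, so that the rules below compose without
    side conditions. *)
Definition has_mean d (Omega : measurableType d) (R : realType)
    (P : probability Omega R) (X : Omega -> R) (r : R) : Prop :=
  P.-integrable setT (EFin \o X) /\ (\int[P]_w (X w)%:E = r%:E)%E.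

Section has_mean.
Context d (Omega : measurableType d) (R : realType) (P : probability Omega R).
Implicit Types (X Y : Omega -> R).

Lemma has_mean_fine X : P.-integrable setT (EFin \o X) ->
  has_mean P X (fine (\int[P]_w (X w)%:E)).
Proof. by move=> iX; split=> //; rewrite fineK// integrable_fin_num. Qed.

Lemma has_mean_cst c : has_mean P (fun=> c) c.
Proof.
split; first exact: finite_measure_integrable_cst.
by rewrite integral_cst//= probability_setT mule1.
Qed.

Lemma has_meanD X Y a b : has_mean P X a -> has_mean P Y b ->
  has_mean P (fun w => X w + Y w) (a + b).
Proof.
move=> [iX EX] [iY EY]; split; first exact: (integrableD measurableT iX iY).
by under eq_integral do rewrite EFinD; rewrite integralD// EX EY.
Qed.

Lemma has_meanZ X c a : has_mean P X a -> has_mean P (fun w => c * X w) (c * a).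
Proof.
move=> [iX EX]; split; first exact: (integrableZl measurableT c iX).
by under eq_integral do rewrite EFinM; rewrite integralZl// EX.
Qed.

Lemma has_mean_sum (I : Type) (s : seq I) (X : I -> Omega -> R) (a : I -> R) :
  (forall i, has_mean P (X i) (a i)) ->
  has_mean P (fun w => \sum_(i <- s) X i w) (\sum_(i <- s) a i).
Proof.
move=> H; elim: s => [|i s IH].
  by rewrite big_nil; under eq_fun do rewrite big_nil; exact: has_mean_cst.
by rewrite big_cons; under eq_fun do rewrite big_cons; exact: has_meanD.
Qed.

Lemma ge0_has_mean X r : measurable_fun setT X -> (forall w, 0 <= X w) ->
  (\int[P]_w (X w)%:E = r%:E)%E -> has_mean P X r.
Proof.
move=> mX X0 EX; split=> //; apply/integrableP; split; first exact/measurable_EFinP.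
under eq_integral do rewrite /= ger0_norm//.
by rewrite EX ltry.
Qed.

Lemma bounded_integrable X C : measurable_fun setT X ->
  (forall w, `|X w| <= C) -> P.-integrable setT (EFin \o X).
Proof.
move=> mX XC; apply: measurable_bounded_integrable => //.
  by rewrite ltey_eq fin_num_measure.
exists C; split; first exact: num_real.
by move=> x Cx w _; exact: le_trans (XC w) (ltW Cx).
Qed.

(** The difference is nonnegative almost everywhere, hence has the integral of
    its absolute value. *)
Lemma le_has_mean X Y a b : has_mean P X a -> has_mean P Y b ->
  {ae P, forall w, X w <= Y w} -> a <= b.
Proof.
move=> mX mY XY; rewrite -subr_ge0.
have [/(measurable_int P) mD ED] := has_meanD mY (has_meanZ (-1) mX).
rewrite -[X in b - X]mul1r -mulNr -lee_fin -ED.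
rewrite (ae_eq_integral (fun w => `|(Y w + -1 * X w)%:E|)%E)//.
- by apply: integral_ge0 => w _; exact: abse_ge0.
- exact: measurableT_comp.
- apply: filterS XY => w XYw _ /=; rewrite ger0_norm//.
  by rewrite mulN1r subr_ge0.
Qed.

End has_mean.

(** * Measurability and boundedness of the energy *)

Lemma measurable_complex_coords (R : realType) :
  measurable_fun setT (@complex_coords R).
Proof. by move=> _ B mB; exists B. Qed.

Lemma measurable_Re (R : realType) : measurable_fun setT (@complex.Re R).
Proof. exact: (measurableT_comp measurable_fst (@measurable_complex_coords R)). Qed.

Lemma measurable_Im (R : realType) : measurable_fun setT (@complex.Im R).
Proof. exact: (measurableT_comp measurable_snd (@measurable_complex_coords R)). Qed.

Section measurable_state.
Context (R : realType) (N : nat).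

Lemma measurable_state_Re j :
  measurable_fun setT (fun v : state R N => complex.Re (tnth v j)).
Proof. exact: (measurableT_comp (@measurable_Re R) (measurable_tnth j)). Qed.

Lemma measurable_state_Im j :
  measurable_fun setT (fun v : state R N => complex.Im (tnth v j)).
Proof. exact: (measurableT_comp (@measurable_Im R) (measurable_tnth j)). Qed.

Lemma measurable_state_normc j :
  measurable_fun setT (fun v : state R N => normc (tnth v j)).
Proof.
rewrite (_ : (fun v : state R N => _) = (fun v : state R N =>
  Num.sqrt (complex.Re (tnth v j) ^+ 2 + complex.Im (tnth v j) ^+ 2))); last first.
  by apply/funext => v; case: (tnth v j).
apply: (measurableT_comp (continuous_measurable_fun (@sqrt_continuous R))).
by apply: measurable_funD; apply: measurable_funX;
  [exact: measurable_state_Re|exact: measurable_state_Im].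
Qed.

Lemma measurable_energy (sigma dx : R) : measurable_fun setT (@energy R N sigma dx).
Proof.
apply: measurable_funB; (apply: measurable_funM => //; apply: measurable_sum => j;
  apply: measurable_funM => //).
  rewrite (_ : (fun v : state R N => _) = (fun v : state R N =>
    (complex.Re (tnth v (right_nb j)) - complex.Re (tnth v j)) ^+ 2 * dx ^- 2 +
    (complex.Im (tnth v (right_nb j)) - complex.Im (tnth v j)) ^+ 2 * dx ^- 2)).
    by apply: measurable_funD; apply: measurable_funM => //; apply: measurable_funX;
      apply: measurable_funB; do ?exact: measurable_state_Re;
      exact: measurable_state_Im.
  apply/funext => v; rewrite normc_sqr Re_div_real Im_div_real !raddfB/=.
  by rewrite !expr_div_n.
exact: (measurableT_comp (@measurable_powR R _) (measurable_state_normc j)).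
Qed.

Lemma measurable_ftilde (dt : R) (A : 'M[R]_N.+1) j :
  measurable_fun setT (fun x : noise R N => ftilde dt A x j).
Proof.
apply: measurable_funM => //; apply: measurable_sum => k.
by apply: measurable_funM => //; exact: measurable_tnth.
Qed.

Lemma mass_ge0 (dx : R) (v : state R N) : 0 <= dx -> 0 <= mass dx v.
Proof. by move=> dx0; rewrite mulr_ge0// sumr_ge0// => j _; rewrite sqr_ge0. Qed.

Lemma normc_sqr_le_mass (dx : R) (v : state R N) j : 0 < dx ->
  normc (tnth v j) ^+ 2 <= mass dx v / dx.
Proof.
move=> dx0; rewrite /mass mulrAC divff ?gt_eqF// mul1r (bigD1 j)//= lerDl.
by rewrite sumr_ge0// => i _; rewrite sqr_ge0.
Qed.

(** On a finite grid the mass controls each |v_j|, hence the energy.  This makes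
    the energies integrable along the scheme, whose mass is constant. *)
Lemma energy_bounded (sigma dx K : R) : 0 <= sigma -> 0 < dx ->
  exists C, forall v : state R N, mass dx v = K -> `|energy sigma dx v| <= C.
Proof.
move=> s0 dx0.
exists (2^-1 * \sum_(j < N.+1) (4 * (K / dx) / dx ^+ 2 * dx) +
  (2 * (sigma + 1))^-1 *
    \sum_(j < N.+1) (Num.sqrt (K / dx) `^ (2 * (sigma + 1)) * dx)).
move=> v mv.
have s1 : 0 <= (2 * (sigma + 1))^-1 by rewrite invr_ge0; lra.
apply: le_trans (ler_normB _ _) _; apply: lerD.
  rewrite ger0_norm; last first.
    by rewrite mulr_ge0// sumr_ge0// => j _; rewrite mulr_ge0 ?sqr_ge0// ltW.
  apply: ler_wpM2l => //; apply: ler_sum => j _; apply: ler_wpM2r; first exact: ltW.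
  rewrite normc_sqr Re_div_real Im_div_real !raddfB/= !expr_div_n -mulrDl.
  apply: ler_wpM2r; first by rewrite invr_ge0 sqr_ge0.
  have := normc_sqr_le_mass v j dx0; have := normc_sqr_le_mass v (right_nb j) dx0.
  rewrite mv !normc_sqr; set a := complex.Re _; set b := complex.Im _.
  set a' := complex.Re _; set b' := complex.Im _.
  have := sqr_ge0 (a + a'); have := sqr_ge0 (b + b'); lra.
rewrite ger0_norm; last first.
  by rewrite mulr_ge0// sumr_ge0// => j _; rewrite mulr_ge0 ?powR_ge0// ltW.
apply: ler_wpM2l => //; apply: ler_sum => j _; apply: ler_wpM2r; first exact: ltW.
apply: ge0_ler_powR; rewrite ?nnegrE ?sqrtr_ge0 ?normc_nonneg//; first by lra.
rewrite -[leLHS]ger0_norm ?normc_nonneg// -sqrtr_sqr ler_sqrt; last first.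
  by rewrite divr_ge0 ?(ltW dx0)// -mv mass_ge0// ltW.
by rewrite -mv; exact: normc_sqr_le_mass.
Qed.

End measurable_state.

(** * One step of the scheme *)

(** That this dominates each y_j only uses 1 + x <= exp x at
    x = lam y_j - ln c; unlike a logarithm of the sum, an affine function of the
    exponentials has an explicit mean. *)
Definition softmax (R : realType) (n : nat) (lam c : R) (y : 'I_n -> R) : R :=
  lam^-1 * (ln c - 1 + c^-1 * \sum_j expR (lam * y j)).

Lemma le_softmax (R : realType) (n : nat) (lam c : R) (y : 'I_n -> R) j :
  0 < lam -> 0 < c -> y j <= softmax lam c y.
Proof.
move=> lam0 c0; rewrite /softmax ler_pdivlMl//.
have := expR_ge1Dx (lam * y j - ln c).
rewrite expRB lnK ?posrE// => H.
have : expR (lam * y j) / c <= c^-1 * \sum_j expR (lam * y j).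
  rewrite mulrC ler_pM2l ?invr_gt0// (bigD1 j)//= lerDl.
  by rewrite sumr_ge0// => i _; exact: expR_ge0.
lra.
Qed.

Lemma average_le_softmax (R : realType) (n : nat) (lam c : R) (p y : 'I_n -> R) :
  0 < lam -> 0 < c -> (forall j, 0 <= p j) ->
  \sum_j p j * y j <= (\sum_j p j) * softmax lam c y.
Proof.
move=> lam0 c0 p0; rewrite mulr_suml; apply: ler_sum => j _.
by apply: ler_wpM2l => //; exact: le_softmax.
Qed.

Section energy_step.
Context (R : realType) (N : nat) (sigma eps dx dt : R) (A : 'M[R]_N.+1).
Context (v w : state R N) (x : noise R N) (lam c : R).
Hypotheses (eps0 : 0 < eps) (dx0 : 0 < dx) (dt0 : 0 < dt).
Hypotheses (lam0 : 0 < lam) (c0 : 0 < c).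
Hypothesis step : mec_step sigma eps dx dt A v x w.

Let f := ftilde dt A x.

Let massE (z : state R N) : mass dx z = \sum_j dx * normc (tnth z j) ^+ 2.
Proof. by rewrite /mass mulr_sumr. Qed.

Let wgt_ge0 (z : state R N) j : 0 <= dx * normc (tnth z j) ^+ 2.
Proof. by rewrite mulr_ge0 ?sqr_ge0// ltW. Qed.

Let stepE : energy sigma dx w - energy sigma dx v = (eps / 2) *
  (\sum_j (dx * normc (tnth w j) ^+ 2) * - f j +
   \sum_j (dx * normc (tnth v j) ^+ 2) * f j).
Proof.
rewrite (energy_increment step) -/f mulNr -mulrN -big_split/= mulr_sumr -sumrN.
by congr (_ * _); apply: eq_bigr => j _; ring.
Qed.

(** The form of the estimate used in the mean: the mass of the new state
    weights the noise (softmax), whereas the term with the old state is linear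
    in f_j and is bounded through t f_j <= exp(t f_j) - 1. *)
Lemma energy_step_le (t : R) : 0 < t ->
  energy sigma dx w <= energy sigma dx v + (eps / 2) *
    (mass dx v * softmax lam c (fun j => - f j) +
     \sum_j dx * normc (tnth v j) ^+ 2 * (t^-1 * (expR (t * f j) - 1))).
Proof.
move=> t0; rewrite -lerBlDl stepE; apply: ler_wpM2l.
  by rewrite divr_ge0// ltW.
apply: lerD.
  rewrite -(mass_conservation _ step) ?gt_eqF// massE.
  exact: average_le_softmax.
apply: ler_sum => j _; apply: ler_wpM2l => //.
rewrite ler_pdivlMl// lerBrDl; exact: expR_ge1Dx.
Qed.

(** The pathwise form of the estimate, used for the maximum over time: both
    weights are bounded by the mass, and the bound is nonnegative by
    softmax_sym_ge0. *)
Lemma energy_step_le_abs :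
  energy sigma dx w <= energy sigma dx v + (eps / 2) *
    (mass dx v * (softmax lam c (fun j => - f j) + softmax lam c f)).
Proof.
rewrite -lerBlDl stepE; apply: ler_wpM2l; first by rewrite divr_ge0// ltW.
rewrite mulrDr; apply: lerD.
  rewrite -(mass_conservation _ step) ?gt_eqF// massE.
  exact: average_le_softmax.
by rewrite massE; exact: average_le_softmax.
Qed.

End energy_step.

Lemma softmax_sym_ge0 (R : realType) (n : nat) (lam c : R) (y : 'I_n.+1 -> R) :
  0 < lam -> 0 < c -> 0 <= softmax lam c (fun j => - y j) + softmax lam c y.
Proof.
move=> lam0 c0.
have := @le_softmax _ _ lam c (fun j => - y j) ord0 lam0 c0.
have := @le_softmax _ _ lam c y ord0 lam0 c0; lra.
Qed.

(** * Mean growth of the energy *)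

Lemma measurable_bigmax d (Omega : measurableType d) (R : realType) (I : Type)
    (s : seq I) (h0 : Omega -> R) (h : I -> Omega -> R) :
  measurable_fun setT h0 -> (forall i, measurable_fun setT (h i)) ->
  measurable_fun setT (fun w => \big[Num.max/h0 w]_(i <- s) h i w).
Proof.
move=> mh0 mh; elim: s => [|i s IH]; first by under eq_fun do rewrite big_nil.
under eq_fun do rewrite big_cons; exact: measurable_maxr.
Qed.

(** From exp(- x) >= 1 - x. *)
Lemma expR_sub1_le (R : realType) (x : R) : 0 <= x -> x <= 2^-1 ->
  expR x - 1 <= 2 * x.
Proof.
move=> x0 x1; have h : 0 < 1 - x by lra.
have e : expR x <= (1 - x)^-1.
  rewrite -[x in expR x]opprK expRN lef_pV2 ?posrE ?expR_gt0//.
  exact: expR_ge1Dx.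
rewrite lerBlDr (le_trans e)// -[leLHS]mul1r ler_pdivrMr//.
nra.
Qed.

Section mec_mean.
Context (R : realType) (d : measure_display) (Omega : measurableType d)
  (P : probability Omega R) (N : nat) (sigma eps dx dt s lam c : R)
  (A : 'M[R]_N.+1) (chi : nat -> Omega -> noise R N).
Hypotheses (lam0 : 0 < lam) (dt0 : 0 < dt) (s0 : 0 < s) (eps0 : 0 < eps)
  (dx0 : 0 < dx) (sigma0 : 0 <= sigma).
Hypothesis noiseP : gaussian_noise P chi.
Hypothesis varA : forall j, dt^-1 * \sum_k A j k ^+ 2 <= s ^+ 2.

Let f m w := ftilde dt A (chi m w).

Let chi_measurable m : measurable_fun setT (chi m).
Proof. by case: noiseP. Qed.

Let measurable_f m j : measurable_fun setT (fun w => f m w j).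
Proof. exact: (measurableT_comp (measurable_ftilde dt A j) (chi_measurable m)). Qed.

Let measurable_exp (t : R) j :
  measurable_fun setT (fun x : noise R N => expR (t * ftilde dt A x j)).
Proof.
apply: measurableT_comp => //; apply: measurable_funM => //.
exact: measurable_ftilde.
Qed.

Lemma ftilde_mmt_gen_fun t m j : exists2 e,
  has_mean P (fun w => expR (t * f m w j)) e & e <= expR (t ^+ 2 * s ^+ 2 / 2).
Proof.
exists (expR (\sum_k (t * (Num.sqrt dt)^-1 * A j k) ^+ 2 / 2)).
  apply: ge0_has_mean => [|w|].
  - exact: (measurableT_comp (measurable_exp t j) (chi_measurable m)).
  - exact: expR_ge0.
  - rewrite -(gaussian_noise_mmt_gen_fun m _ noiseP).
    apply: eq_integral => w _; congr (expR _)%:E.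
    rewrite /f /ftilde !mulr_sumr; apply: eq_bigr => k _; ring.
rewrite ler_expR -mulr_suml ler_pM2r ?invr_gt0//.
under eq_bigr do rewrite !exprMn exprVn sqr_sqrtr ?(ltW dt0)// -mulrA.
by rewrite -mulr_sumr ler_wpM2l ?sqr_ge0// -mulr_sumr.
Qed.

(** The condition on c makes the exponential part of softmax at most 1 in mean,
    which the summand - 1 compensates.  The sign y serves both tails. *)
Lemma softmax_mean (y : R) m : y ^+ 2 = 1 ->
  0 < c -> N.+1%:R * expR (lam ^+ 2 * s ^+ 2 / 2) <= c ->
  exists2 q, has_mean P (fun w => softmax lam c (fun j => y * f m w j)) q &
    q <= ln c / lam.
Proof.
move=> y1 c0 hc.
have /choice[e He] j : exists e,
    has_mean P (fun w => expR (lam * (y * f m w j))) e /\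
    e <= expR (lam ^+ 2 * s ^+ 2 / 2).
  have [e eE ele] := ftilde_mmt_gen_fun (lam * y) m j.
  exists e; split; first by under eq_fun do rewrite mulrA.
  by move: ele; rewrite exprMn y1 mulr1.
exists (lam^-1 * (ln c - 1 + c^-1 * \sum_j e j)).
  apply: has_meanZ; apply: has_meanD; first exact: has_mean_cst.
  by apply: has_meanZ; apply: has_mean_sum => j; exact: (He j).1.
rewrite [leRHS]mulrC ler_pM2l ?invr_gt0// -[leRHS]addr0 -addrA lerD2l.
rewrite addrC subr_le0 ler_pdivrMl// mulr1 (le_trans _ hc)//.
rewrite (le_trans (ler_sum _ (fun j _ => (He j).2)))//.
by rewrite sumr_const card_ord mulr_natl.
Qed.

Variables (u0 : state R N) (u : nat -> Omega -> option (state R N)).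
Hypothesis uP : mec_solution sigma eps dx dt A chi u0 u.
Let K := mass dx u0.
Let V m w := odflt u0 (u m w).
Let H m w := oenergy sigma dx (u m w).

Let chi_indep n (B : nat -> set (noise R N)) : (forall i, measurable (B i)) ->
  P [set w | forall i, (i < n)%N -> B i (chi i w)] =
  (\prod_(i < n) fine (P (chi i @^-1` B i)))%:E.
Proof.
move=> mB; apply: (mutually_independent_iota (f := id) (g := id)) => //.
by case: noiseP.
Qed.

Let measurable_u m : partial_measurable (u m).
Proof.
have [F [_ _ mF] uE] := uP.
apply: (recursion_measurable (X := chi) (Y := u) (F := F) (y0 := u0)) => //.
- by move=> w; have [] := uE w.
- by move=> k w; have [_] := uE w.
Qed.

Let measurable_V m : measurable_fun setT (V m).
Proof. exact: measurable_odflt. Qed.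

Let measurable_H m : measurable_fun setT (H m).
Proof. by apply: measurable_oapp => //; exact: measurable_energy. Qed.

Let V_indep m B D : measurable B -> measurable D ->
  P (V m @^-1` B `&` chi m @^-1` D) = (P (V m @^-1` B) * P (chi m @^-1` D))%E.
Proof.
move=> mB mD; have [F [_ _ mF] uE] := uP.
have Y0 w : u 0%N w = Some u0 by have [] := uE w.
have YS k w : u k.+1 w = obind (fun v => F k v (chi k w)) (u k w).
  by have [_] := uE w.
exact: (recursion_independent_total chi_measurable (@chi_indep m.+1) Y0 YS mF
  (ltnSn m)).
Qed.

Lemma solution_step m w v' : u m.+1 w = Some v' ->
  exists2 v, u m w = Some v & mec_step sigma eps dx dt A v (chi m w) v'.
Proof.
have [F [FS _ _] uE] := uP; have [_ ->] := uE w.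
by case: (u m w) => [v|]//= /FS; exists v.
Qed.

Lemma solution_mass m w v : u m w = Some v -> mass dx v = K.
Proof.
elim: m v => [|m IH] v.
  by have [F _ uE] := uP; have [-> _] := uE w => -[<-].
case/solution_step => v' /IH <-; apply: mass_conservation.
by rewrite gt_eqF.
Qed.

Let mass_V m w : mass dx (V m w) = K.
Proof. by rewrite /V; case E : (u m w) => [v|]//=; exact: solution_mass E. Qed.

(** The mass is the initial one for every outcome where the state is defined,
    and undefined states count for 0. *)
Lemma solution_energy_bounded : exists2 C, 0 <= C & forall m w, `|H m w| <= C.
Proof.
have [C HC] := @energy_bounded _ N sigma dx K sigma0 dx0.
exists C; first by apply: le_trans (HC u0 erefl).
move=> m w; rewrite /H /oenergy; case E : (u m w) => [v|]/=.
  by apply: HC; exact: solution_mass E.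
by rewrite normr0; apply: le_trans (HC u0 erefl).
Qed.

Let weight m j w := dx * normc (tnth (V m w) j) ^+ 2.

Let weight_ge0 m j w : 0 <= weight m j w.
Proof. by rewrite mulr_ge0 ?sqr_ge0// ltW. Qed.

Let sum_weight m w : \sum_j weight m j w = K.
Proof. by rewrite -mulr_sumr -/(mass dx _) mass_V. Qed.

Let measurable_weight j :
  measurable_fun setT (fun v : state R N => dx * normc (tnth v j) ^+ 2).
Proof.
apply: measurable_funM => //; apply: measurable_funX.
exact: measurable_state_normc.
Qed.

Lemma weight_mean m : exists2 p : 'I_N.+1 -> R,
  (forall j, has_mean P (weight m j) (p j) /\ 0 <= p j) & \sum_j p j = K.
Proof.
have iw j : P.-integrable setT (EFin \o weight m j).
  apply: (@bounded_integrable _ _ _ _ _ K).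
    exact: (measurableT_comp (measurable_weight j) (measurable_V m)).
  move=> w; rewrite ger0_norm// -(sum_weight m w) (bigD1 j)//= lerDl.
  by rewrite sumr_ge0.
exists (fun j => fine (\int[P]_w (weight m j w)%:E)).
  move=> j; split; first exact: has_mean_fine.
  by apply: fine_ge0; apply: integral_ge0 => w _; rewrite lee_fin.
have [_ E1] := has_mean_sum (index_enum 'I_N.+1) (fun j => has_mean_fine (iw j)).
have [_ E2] := has_mean_cst P K.
by apply: EFin_inj; rewrite -E1 -E2; apply: eq_integral => w _; rewrite sum_weight.
Qed.

(** The state at time m is independent of the noise of step m, so the mean of
    the product factors. *)
Lemma weighted_mmt_gen_fun t m j e p :
  has_mean P (fun w => expR (t * f m w j)) e -> has_mean P (weight m j) p ->
  has_mean P (fun w => weight m j w * (t^-1 * (expR (t * f m w j) - 1)))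
    (t^-1 * (p * e - p)).
Proof.
move=> He Hp.
rewrite (_ : (fun w => _) = (fun w => t^-1 *
   (weight m j w * expR (t * f m w j) + -1 * weight m j w))); last first.
  by apply/funext => w; ring.
rewrite (_ : p * e - p = p * e + -1 * p); last by ring.
apply: has_meanZ; apply: has_meanD; last exact: has_meanZ.
apply: ge0_has_mean => [|w|].
- apply: measurable_funM.
    exact: (measurableT_comp (measurable_weight j) (measurable_V m)).
  exact: (measurableT_comp (measurable_exp t j) (chi_measurable m)).
- by rewrite mulr_ge0// expR_ge0.
- have := expectationM (measurable_V m) (chi_measurable m) (@V_indep m)
    (measurable_weight j) (measurable_exp t j).
  move=> ->; first by rewrite EFinM -(proj2 He) -(proj2 Hp).
  + by move=> v; rewrite mulr_ge0 ?sqr_ge0// ltW.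
  + by move=> x; exact: expR_ge0.
Qed.

Variable M : nat.
Hypothesis survive : {ae P, forall w, u M w <> None}.

Let u_some_le m n w : (m <= n)%N -> u n w <> None -> exists v, u m w = Some v.
Proof.
move=> mn; rewrite -(subnK mn); elim: (n - m)%N => [|k IH].
  by rewrite add0n; case: (u m w) => [v|]// _; exists v.
rewrite addSn; case E : (u _ w) => [v|]// _; apply: IH.
by have [v' -> _] := solution_step E.
Qed.

Hypotheses (c0 : 0 < c) (hc : N.+1%:R * expR (lam ^+ 2 * s ^+ 2 / 2) <= c).
Let S := ln c / lam.
Let K0 : 0 <= K. Proof. by rewrite mass_ge0// ltW. Qed.

Let NfE m w : (fun j => - f m w j) = (fun j => -1 * f m w j).
Proof. by apply/funext => j; rewrite mulN1r. Qed.

(** The parameter t stays free: the last term tends to 0 with t. *)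
Let mean_step m t h h' : 0 < t -> (m < M)%N ->
  has_mean P (H m) h -> has_mean P (H m.+1) h' ->
  h' <= h + (eps / 2) * K * (S + t^-1 * (expR (t ^+ 2 * s ^+ 2 / 2) - 1)).
Proof.
move=> t0 mM hm hm1.
have [p Hp pK] := weight_mean m.
have /choice[e He] j : exists e, has_mean P (fun w => expR (t * f m w j)) e /\
    e <= expR (t ^+ 2 * s ^+ 2 / 2).
  by have [e eE ele] := ftilde_mmt_gen_fun t m j; exists e.
have [q Hq qS] := softmax_mean m (sqrr_sign R 1) c0 hc.
rewrite expr1 in Hq.
pose B w := H m w + (eps / 2) * (K * softmax lam c (fun j => -1 * f m w j) +
  \sum_j weight m j w * (t^-1 * (expR (t * f m w j) - 1))).
have HB : has_mean P B (h + (eps / 2) * (K * q + \sum_j t^-1 * (p j * e j - p j))).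
  apply: has_meanD => //; apply: has_meanZ; apply: has_meanD; first exact: has_meanZ.
  apply: has_mean_sum => j; apply: weighted_mmt_gen_fun; first exact: (He j).1.
  exact: (Hp j).1.
apply: le_trans (le_has_mean hm1 HB _) _.
  apply: filterS survive => w /(u_some_le mM)[v' uv'].
  have [v uv vv'] := solution_step uv'.
  rewrite /B /weight /V /H /oenergy uv uv'/= -(solution_mass uv) -NfE.
  exact: energy_step_le.
rewrite lerD2l -[leRHS]mulrA; apply: ler_wpM2l; first by rewrite divr_ge0// ltW.
rewrite mulrDr; apply: lerD; first exact: ler_wpM2l.
rewrite -pK mulr_suml; apply: ler_sum => j _.
rewrite [leRHS]mulrCA ler_pM2l ?invr_gt0// mulrBr mulr1 lerD2r.
by apply: ler_wpM2l; [exact: (Hp j).2|exact: (He j).2].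
Qed.

Let H0E : H 0%N = fun=> energy sigma dx u0.
Proof.
apply/funext => w; have [F _ uE] := uP; have [e _] := uE w.
by rewrite /H /oenergy e.
Qed.

Let integrable_H m : P.-integrable setT (EFin \o H m).
Proof.
have [C _ HC] := solution_energy_bounded.
exact: bounded_integrable (measurable_H m) (HC m).
Qed.

(** After M applications of mean_step, t -> 0. *)
Lemma energy_mean_le :
  ('E_P[H M] <= (energy sigma dx u0 + (eps / 2) * K * S * M%:R)%:E)%E.
Proof.
pose h m := fine (\int[P]_w (H m w)%:E).
have iH m : has_mean P (H m) (h m) := has_mean_fine (integrable_H m).
rewrite unlock (proj2 (iH M)) lee_fin.
pose g t := t^-1 * (expR (t ^+ 2 * s ^+ 2 / 2) - 1).
have hg t : 0 < t -> h M <= energy sigma dx u0 + (eps / 2) * K * (S + g t) * M%:R.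
  move=> t0; suff : forall m, (m <= M)%N ->
      h m <= energy sigma dx u0 + (eps / 2) * K * (S + g t) * m%:R by apply.
  elim=> [_|m IH mM].
    rewrite mulr0 addr0 /h H0E.
    by rewrite (proj2 (has_mean_cst P _)).
  apply: le_trans (mean_step t0 mM (iH m) (iH m.+1)) _.
  rewrite -/(g t); have := IH (ltnW mM); set G := eps / 2 * K * _.
  by rewrite -natr1 mulrDr mulr1 addrA lerD2r.
pose B := eps / 2 * K * M%:R.
have B0 : 0 <= B by rewrite /B mulr_ge0// mulr_ge0// divr_ge0// ltW.
apply/ler_addgt0Pr => a a0.
have D0 : 0 < B * s ^+ 2 + 1 by rewrite ltr_pwDr// mulr_ge0// sqr_ge0.
(* The first bound on t allows expR_sub1_le, the second one makes the error at
   most a; the summand 1 avoids a division by zero. *)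
pose t := Num.min s^-1 (a / (B * s ^+ 2 + 1)).
have t0 : 0 < t by rewrite lt_min invr_gt0 s0/= divr_gt0.
apply: le_trans (hg t t0) _.
have gt : g t <= t * s ^+ 2.
  rewrite ler_pdivrMl//.
  apply: (le_trans (expR_sub1_le _ _)).
  - by rewrite divr_ge0// mulr_ge0 ?sqr_ge0.
  - rewrite ler_pdivrMr// mulVf// -exprMn expr_le1//; last by rewrite mulr_ge0// ltW.
    by rewrite -ler_pdivlMr// div1r ge_min lexx.
  - by rewrite mulrCA divff// mulr1; nra.
have ta : t * (B * s ^+ 2 + 1) <= a.
  by rewrite -ler_pdivlMr// ge_min lexx orbT.
have : B * g t <= B * (t * s ^+ 2) by exact: ler_wpM2l.
rewrite (_ : eps / 2 * K * (S + g t) * M%:R =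
  eps / 2 * K * S * M%:R + B * g t); last first.
  by rewrite /B; ring.
nra.
Qed.

(** The pathwise bounds of the steps are nonnegative, so their sum over all
    steps dominates the energy at each time m <= M. *)
Lemma max_energy_mean_le :
  ('E_P[fun w => \big[Num.max/H 0%N w]_(m < M.+1) H m w] <=
   (energy sigma dx u0 + eps * K * S * M%:R)%:E)%E.
Proof.
set X := fun w => _.
have mX : measurable_fun setT X by exact: measurable_bigmax.
have [C C0 HC] := solution_energy_bounded.
have iX : P.-integrable setT (EFin \o X).
  apply: (@bounded_integrable _ _ _ _ _ C) => // w.
  rewrite ler_norml; apply/andP; split.
    apply: le_trans (bigmax_ge_id _ _ _ _).
    by have := HC 0%N w; rewrite ler_norml => /andP[].
  by apply: bigmax_le => [|m _]; apply: le_trans (ler_norm _) _; exact: HC.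
have HX := has_mean_fine iX.
have /choice[q Hq] m : exists q,
    has_mean P (fun w => softmax lam c (fun j => -1 * f m w j)) q /\ q <= S.
  have [q Hq qS] := softmax_mean m (sqrr_sign R 1) c0 hc.
  by exists q; split=> //; rewrite expr1 in Hq.
have /choice[q' Hq'] m : exists q,
    has_mean P (fun w => softmax lam c (fun j => 1 * f m w j)) q /\ q <= S.
  by have [q' Hq' qS] := softmax_mean m (expr1n R 2) c0 hc; exists q'.
pose Z m w :=
  softmax lam c (fun j => -1 * f m w j) + softmax lam c (fun j => 1 * f m w j).
have Z0 m w : 0 <= Z m w.
  rewrite /Z -NfE; under [X in _ + softmax _ _ X]eq_fun do rewrite mul1r.
  exact: softmax_sym_ge0.
pose Y w := energy sigma dx u0 + eps / 2 * K * \sum_(m < M) Z m w.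
have HY : has_mean P Y
    (energy sigma dx u0 + eps / 2 * K * \sum_(m < M) (q m + q' m)).
  apply: has_meanD; first exact: has_mean_cst.
  apply: has_meanZ; apply: has_mean_sum => m; apply: has_meanD.
    exact: (Hq m).1.
  exact: (Hq' m).1.
rewrite unlock (proj2 HX) lee_fin; apply: le_trans (le_has_mean HX HY _) _.
  apply: filterS survive => w uM.
  have eK : 0 <= eps / 2 * K by rewrite mulr_ge0// divr_ge0// ltW.
  have step m : (m <= M)%N ->
      H m w <= energy sigma dx u0 + eps / 2 * K * \sum_(i < m) Z i w.
    elim: m => [_|m IH mM]; first by rewrite big_ord0 mulr0 addr0 H0E.
    have [v' uv'] := u_some_le mM uM.
    have [v uv vv'] := solution_step uv'.
    rewrite big_ord_recr/= mulrDr addrA.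
    apply: le_trans (lerD (IH (ltnW mM)) (lexx _)).
    rewrite -mulrA -(solution_mass uv) /H /oenergy uv uv' /Z -NfE.
    under [X in _ + softmax _ _ X]eq_fun do rewrite mul1r.
    exact: energy_step_le_abs.
  have stepM m : (m <= M)%N -> H m w <= Y w.
    move=> mM; apply: le_trans (step m mM) _; rewrite lerD2l; apply: ler_wpM2l => //.
    (* Extending the sum to all steps only adds nonnegative terms. *)
    rewrite -(big_mkord xpredT (Z^~ w)) -(big_mkord xpredT (Z^~ w)).
    by rewrite (big_cat_nat (leq0n m) mM)//= lerDl sumr_ge0.
  by apply: bigmax_le => [|m _]; apply: stepM => //; rewrite -ltnS.
rewrite lerD2l (_ : eps * K * S * M%:R =
  eps / 2 * K * \sum_(m < M) (S + S)); last first.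
  by rewrite sumr_const card_ord -mulr_natl; field.
apply: ler_wpM2l; first by rewrite mulr_ge0// divr_ge0// ltW.
by apply: ler_sum => m _; apply: lerD; [exact: (Hq m).2|exact: (Hq' m).2].
Qed.

End mec_mean.

(** * The mean energy and the mean of its maximum *)

Theorem proposition4p1 (R : realType) (d : measure_display)
    (Omega : measurableType d) (P : probability Omega R)
    (sigma eps Lc dt delta : R) (N : nat)
    (hsigma : 2 <= sigma) (heps : 0 < eps) (hLc : 0 < Lc)
    (hN : (1 <= N)%N) (hdt : 0 < dt) (hdelta : 0 < delta)
    (mu : {measure set (measurableTypeR R) -> \bar R})
    (hmu_tempered : tempered_measure mu) (hmu_sym : symmetric_measure mu)
    (Phi : R -> R) (hPhi : fourier_density mu Phi)
    (hGamma : symmetric_posdef (Gammatilde Lc N Phi))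
    (A : 'M[R]_N.+1) (hA : cholesky (Gammatilde Lc N Phi) A)
    (chi : nat -> Omega -> noise R N) (hchi : gaussian_noise P chi)
    (u_init : R -> R[i]) (hu_init : H1 u_init)
    (u0 : state R N) (hu0 : forall j, tnth u0 j = u_init (gridpt Lc N j))
    (u : nat -> Omega -> option (state R N))
    (hu : mec_solution sigma eps (mesh Lc N) dt A chi u0 u)
    (hsup : forall k, Gammatilde Lc N Phi k k <= delta ^+ 2)
    (M : nat)
    (htau : {ae P, forall w, ((M%:R * dt)%:E < existence_time dt u w)%E})
    (hdx : 0 < mesh Lc N < 1) :
  ('E_P[fun w => oenergy sigma (mesh Lc N) (u M w)] <=
    (energy sigma (mesh Lc N) u0 +
     eps * mass (mesh Lc N) u0 / (Num.sqrt 2 * dt `^ (3 / 2)) * delta *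
     Num.sqrt (ln (4 * Lc) + `|ln (mesh Lc N)|) * (M%:R * dt))%:E)%E
  /\
  ('E_P[fun w => \big[Num.max/oenergy sigma (mesh Lc N) (u 0%N w)]_(m < M.+1)
                   oenergy sigma (mesh Lc N) (u m w)] <=
    (energy sigma (mesh Lc N) u0 +
     Num.sqrt 2 * eps * mass (mesh Lc N) u0 / dt `^ (3 / 2) * delta *
     Num.sqrt (ln (4 * Lc) + `|ln (mesh Lc N)|) * (M%:R * dt))%:E)%E.
Proof.
have dx0 : 0 < mesh Lc N by case/andP: hdx.
have dx1 : mesh Lc N < 1 by case/andP: hdx.
have N0 : 0 < (N%:R : R) by rewrite ltr0n.
(* r = 4 Lc / dx is the argument of the logarithm of the statement. *)
pose r : R := 2 * N%:R.
have r2 : 2 <= r by rewrite /r ler_peMr// ler1n.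
have r0 : 0 < r by lra.
have rE : r = 4 * Lc / mesh Lc N by rewrite /r /mesh; field; rewrite !gt_eqF.
pose L := ln r.
have L0 : 0 < L by rewrite ln_gt0; lra.
have LE : ln (4 * Lc) + `|ln (mesh Lc N)| = L.
  rewrite ltr0_norm ?ln_lt0 ?dx0// /L rE ln_div// posrE.
  by rewrite mulr_gt0.
have sdt0 : 0 < Num.sqrt dt by rewrite sqrtr_gt0.
pose s := delta / Num.sqrt dt.
have s0 : 0 < s by rewrite divr_gt0.
(* This lam minimizes L / lam + lam s^2 / 2; then lam^2 s^2 / 2 = L and
   softmax is used with c = r exp L = r^2. *)
pose lam := Num.sqrt (2 * L) / s.
have lam0 : 0 < lam by rewrite divr_gt0// sqrtr_gt0 mulr_gt0.
have lams : lam ^+ 2 * s ^+ 2 / 2 = L.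
  rewrite -exprMn divfK ?gt_eqF// sqr_sqrtr; first by field.
  by rewrite mulr_ge0// ltW.
have [_ _ GA] := hA.
have varA j : dt^-1 * \sum_k A j k ^+ 2 <= s ^+ 2.
  rewrite /s expr_div_n sqr_sqrtr ?(ltW hdt)// [leRHS]mulrC ler_pM2l ?invr_gt0//.
  have := hsup j; rewrite GA mxE; under eq_bigr do rewrite mxE -expr2; exact.
(* N + 1 <= 2 N because N >= 1. *)
have hc : N.+1%:R * expR (lam ^+ 2 * s ^+ 2 / 2) <= r ^+ 2.
  rewrite lams lnK ?posrE// expr2 ler_pM2r// /r -natrM ler_nat.
  by rewrite mul2n -addnn -addn1 leq_add2l.
(* If u^M were undefined, M dt would be one of the times whose infimum is the
   existence time. *)
have survive : {ae P, forall w, u M w <> None}.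
  apply: filterS htau => w + uM; rewrite ltNge => /negP; apply.
  by apply: ereal_inf_lbound; exists M.
have sqrtE : Num.sqrt (2 * L) = Num.sqrt 2 * Num.sqrt L by rewrite sqrtrM.
have SE : ln (r ^+ 2) / lam = Num.sqrt 2 * Num.sqrt L * delta / Num.sqrt dt.
  rewrite lnXn// -/L (_ : L *+ 2 = Num.sqrt (2 * L) ^+ 2); last first.
    by rewrite sqr_sqrtr; [rewrite mulr_natl|rewrite mulr_ge0// ltW].
  rewrite /lam invf_div sqrtE /s; field.
  by rewrite !gt_eqF// sqrtr_gt0.
have dt32 : dt `^ (3 / 2) = dt * Num.sqrt dt.
  rewrite (_ : 3 / 2 = 1 + 2^-1); last by field.
  rewrite powRD; last by apply/implyP => _; rewrite gt_eqF.
  by rewrite powRr1 ?ltW// powR12_sqrt// ltW.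
have c0 : 0 < r ^+ 2 by rewrite exprn_gt0.
have sigma0 : 0 <= sigma by lra.
have sq2 : Num.sqrt 2 ^+ 2 = 2 :> R by rewrite sqr_sqrtr.
have sq20 : 0 < Num.sqrt 2 :> R by rewrite sqrtr_gt0.
split.
  apply: le_trans (energy_mean_le lam0 hdt s0 heps dx0 sigma0 hchi varA hu
    survive c0 hc) _.
  rewrite lee_fin lerD2l SE LE dt32 le_eqVlt; apply/orP; left; apply/eqP.
  rewrite (_ : eps / 2 = eps / Num.sqrt 2 ^+ 2); last by rewrite sq2.
  by field; rewrite !gt_eqF.
apply: le_trans (max_energy_mean_le lam0 hdt heps dx0 sigma0 hchi varA hu
  survive c0 hc) _.
rewrite lee_fin lerD2l SE LE dt32 le_eqVlt; apply/orP; left; apply/eqP.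
by field; rewrite !gt_eqF.
Qed.
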